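(* Let $(F_j)_{j=0}^\infty$ be a JTG family with associated spaces $JT_{\mathcal F_{2,s}}$ and $JT_{\mathcal F_s}$. Let $Y$ be an (infinite dimensional closed) subspace either of $JT_{\mathcal F_{2,s}}$ or of $JT_{\mathcal F_s}$. Then for every $\varepsilon>0$ there exists a subspace of $Y$ which is $1+\varepsilon$ isomorphic to $c_0$.
   Context: $c_{00}(\mathbb N)$ is the space of finitely supported real sequences with unit vectors $(e_n)$; $e_n^*$ is the same unit vector regarded as a functional; $f\in c_{00}(\mathbb N)$ acts by $f(x)=\sum_nf(n)x(n)$; $Ef$ is the restriction of $f$ to an interval $E$; $f<g$ means $\max\operatorname{supp}f<\min\operatorname{supp}g$, and a block sequence is one with successive supports. A James Tree Generating (JTG) family is a sequence $(F_j)_{j=0}^\infty$ of subsets of $c_{00}(\mathbb N)$ such that: (A) $F_0=\{\pm e_n^*:n\in\mathbb N\}$ and each $F_j$ is nonempty, countable, symmetric, compact in the topology of pointwise convergence and closed under restrictions to intervals of $\mathbb N$; (B) setting $\tau_j=\sup\{\|f\|_\infty:f\in F_j\}$, the sequence $(\tau_j)_{j\in\mathbb N}$ is strictly decreasing and $\sum_{j=1}^\infty\tau_j\le1$; (C) for every block sequence $(x_k)$ of $c_{00}(\mathbb N)$, every $j\ge0$ and every $\delta>0$ there is $x\in\mathrm{span}\{x_k:k\in\mathbb N\}$ with $\delta\cdot\sup\{f(x):f\in\bigcup_{i\ge0}F_i\}>\sup\{f(x):f\in F_j\}$. Fix disjoint infinite $\Xi_1,\Xi_2\subset\mathbb N$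 and an injective $\sigma_{\mathcal F}$ from the set of finite sequences $(f_1<\dots<f_d)$ in $\bigcup_{j\ge1}F_j\setminus\{0\}$ into $\Xi_2$ with $\sigma_{\mathcal F}(f_1,\dots,f_d)>\max\{k:\exists i,\ f_i\in F_k\}$. A finite or infinite block sequence $s=(f_i)_i$ in $\bigcup_{j\ge1}F_j\setminus\{0\}$ is $\sigma_{\mathcal F}$ special if $f_1\in\bigcup_{l\in\Xi_1}F_l$ and $f_{i+1}\in F_{\sigma_{\mathcal F}(f_1,\dots,f_i)}$ for all $i$; $\operatorname{ind}_s(f_1)=\min\{j:f_1\in F_j\}$, $\operatorname{ind}_s(f_i)=\sigma_{\mathcal F}(f_1,\dots,f_{i-1})$ for $i\ge2$. A finitely supported $\sigma_{\mathcal F}$ special functional is $x^*=E\sum_if_i$ with $s=(f_i)_i$ special and $E$ a finite interval; its index set is $\operatorname{ind}(x^* )=\{\operatorname{ind}_s(f_i):Ef_i\ne0\}$ (pairwise disjointness of indices of several functionals is meant for some choice of representing sequences and intervals). For $f\in\bigcup_{i\ge1}F_i\setminus\{0\}$ used as a single functional, $\operatorname{ind}(f)=\{\min\{j\ge1:f\in F_j\}\}$. Let $\mathscr S$ be the set of finitely supported $\sigma_{\mathcal F}$ special functionals. $\mathcal F_{2,s}=F_0\cup\{\sum_{k=1}^da_kx_k^*:a_k\in\mathbb Q,\ \sum a_k^2\le1,\ x_k^*\in\mathscr S\cup\bigcup_{i\ge1}F_i,\ (\operatorname{ind}(x_k^* ))_{k=1}^d$ pairwise disjoint, $\min\operatorname{supp}x_k^*\ge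 d\}$; $\mathcal F_s=F_0\cup\{\sum_{k=1}^d\varepsilon_kx_k^*:\varepsilon_k\in\{-1,1\},\ x_k^*\in\mathscr S\cup\bigcup_{i\ge1}F_i,\ (\operatorname{ind}(x_k^* ))_{k=1}^d$ pairwise disjoint, $\min\operatorname{supp}x_k^*\ge d,\ d\in\mathbb N\}$. $JT_{\mathcal F_{2,s}}$ and $JT_{\mathcal F_s}$ are the completions of $c_{00}(\mathbb N)$ under the norms $\sup\{f(x):f\in\mathcal F_{2,s}\}$ and $\sup\{f(x):f\in\mathcal F_s\}$ respectively. Two spaces are $1+\varepsilon$ isomorphic if there is an isomorphism $T$ between them with $\|T\|\,\|T^{-1}\|\le1+\varepsilon$.
   Formalization: In the definition of a JTG family, compactness and closure under restrictions (with the other conditions of (A)) are required only of F_j with j ≥ 1, since F_0 = {±e_n^*} does not contain 0 and so is neither pointwise compact nor closed under restrictions to intervals. *)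

(* Defs.v *)
From HB Require Import structures.
From mathcomp Require Export all_boot all_order all_algebra.
From mathcomp Require Export all_classical all_reals all_analysis.
Export Order.TTheory GRing.Theory Num.Theory.
Export numFieldNormedType.Exports.

Set Implicit Arguments.
Unset Strict Implicit.
Unset Printing Implicit Defensive.

Global Open Scope classical_set_scope.
Global Open Scope ring_scope.

(* The coordinate [n : nat] of a sequence stands for the n.+1-st coordinate of a
   sequence indexed by {1, 2, ...}.  This matters only for the condition
   d <= min supp, see [supp_from].  The indices [j] of the sets F_j are not
   shifted: they start from 0, as usual. *)

Section C00.
Variable R : realType.

Definition c00_pred : {pred nat -> R^o} :=
  mem [set u : nat -> R^o | finite_set [set n | u n != 0]].

Record c00 := C00 { c00_val :> nat -> R^o; _ : c00_val \in c00_pred }.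

HB.instance Definition _ := [isSub for c00_val].
HB.instance Definition _ := [Choice of c00 by <:].

Lemma c00_submod_closed : submod_closed c00_pred.
Proof.
split.
  apply: mem_set; apply: (@sub_finite_set _ _ set0) => //.
  by move=> n /=; rewrite eqxx.
move=> a u v /set_mem/= fu /set_mem/= fv; apply: mem_set => /=.
apply: (@sub_finite_set _ _ ([set n | u n != 0] `|` [set n | v n != 0])).
  move=> n /=; case: (eqVneq (u n) 0) => [u0|]; last by left.
  case: (eqVneq (v n) 0) => [v0|]; last by right.
  by rewrite !fctE u0 v0 scaler0 addr0 eqxx.
by rewrite finite_setU.
Qed.

HB.instance Definition _ :=
  GRing.isSubmodClosed.Build _ _ c00_pred c00_submod_closed.
HB.instance Definition _ := [SubChoice_isSubLmodule of c00 by <:].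

Lemma unitvec_subproof k : (fun n => (n == k)%:R : R^o) \in c00_pred.
Proof.
apply: mem_set => /=; apply: (@sub_finite_set _ _ [set k]) => // n /=.
by case: (n =P k) => // _; rewrite /= eqxx.
Qed.

Definition unitvec (k : nat) : c00 := C00 (unitvec_subproof k).

Lemma restr_subproof (E : interval nat) (f : c00) :
  (fun n => if n \in E then f n else 0 : R^o) \in c00_pred.
Proof.
case: f => f /= /set_mem/= ff; apply: mem_set => /=.
apply: sub_finite_set ff => n /=.
by case: ifP => // _; rewrite eqxx.
Qed.

Definition restr (E : interval nat) (f : c00) : c00 := C00 (restr_subproof E f).

Definition act (f x : c00) : R := \sum_(n \in [set: nat]) f n * x n.

Definition act_sup (A : set c00) (x : c00) : \bar R :=
  ereal_sup [set (act f x)%:E | f in A].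

Definition supnorm (f : c00) : \bar R :=
  ereal_sup [set `|f n|%:E | n in [set: nat]].

Definition precedes (f g : c00) : Prop :=
  forall m n : nat, f m != 0 -> g n != 0 -> (m < n)%N.

(* [s] restricted to the index set [A] is a block sequence; its terms are
   nonzero, as max supp and min supp are to be defined. *)
Definition block_on (A : set nat) (s : nat -> c00) : Prop :=
  (forall i, A i -> s i != 0) /\
  (forall i j, A i -> A j -> (i < j)%N -> precedes (s i) (s j)).

(* d <= min supp x, where min supp is computed with coordinates starting at 1 *)
Definition supp_from (d : nat) (x : c00) : Prop :=
  forall n : nat, x n != 0 -> (d <= n.+1)%N.

Definition span_of (x : nat -> c00) : set c00 :=
  [set y | exists (n : nat) (a : nat -> R), y = \sum_(k < n) a k *: x k].

End C00.
Arguments unitvec {R} k.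

Section JTG.
Variable R : realType.
Variable F : nat -> set (c00 R).

Definition tau (j : nat) : \bar R := ereal_sup [set supnorm f | f in F j].

(* The requirements on "each F_j" are imposed for 1 <= j only: F_0, which is
   exactly the set of the signed unit vectors, does not contain 0 and therefore
   is neither pointwise compact nor closed under restrictions. *)
Definition JTG : Prop :=
  [/\ F 0%N = [set f | exists n, f = unitvec n \/ f = - unitvec n],
      forall j, (1 <= j)%N ->
        [/\ F j !=set0,
            countable (F j),
            forall f, F j f -> F j (- f),
            compact ((fun f : c00 R => f : {ptws nat -> R}) @` F j) &
            forall (E : interval nat) f, F j f -> F j (restr E f)],
      forall i j, (1 <= i)%N -> (i < j)%N -> (tau j < tau i)%E,
      (\sum_(1 <= j <oo) tau j <= 1)%E &
      forall x : nat -> c00 R, block_on [set: nat] x ->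
        forall (j : nat) (delta : R), 0 < delta ->
        exists2 y, span_of x y &
          (act_sup (F j) y < delta%:E * act_sup (\bigcup_i F i) y)%E].

Definition Fpos : set (c00 R) := \bigcup_(j in [set j | (1 <= j)%N]) F j.

(* the domain of the coding function *)
Definition block_tuple (t : seq (c00 R)) : Prop :=
  [/\ t <> [::], block_on [set i | (i < size t)%N] (nth 0 t) &
      forall f, f \in t -> Fpos f].

Variables Xi1 Xi2 : set nat.
Variable sigma : seq (c00 R) -> nat.

Definition coding : Prop :=
  [/\ Xi1 `|` Xi2 `<=` [set j | (1 <= j)%N],
      infinite_set Xi1 /\ infinite_set Xi2,
      Xi1 `&` Xi2 = set0,
      set_fun block_tuple Xi2 sigma /\ set_inj block_tuple sigma &
      forall t, block_tuple t ->
        forall f k, f \in t -> F k f -> (k < sigma t)%N].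

(* index set of a sequence of length [L], [None] being an infinite length *)
Definition below (L : option nat) : set nat :=
  if L is Some l then [set i | (i < l)%N] else setT.

Definition special (s : nat -> c00 R) (L : option nat) : Prop :=
  [/\ below L 0%N,
      block_on (below L) s,
      forall i, below L i -> Fpos (s i),
      exists2 l, Xi1 l & F l (s 0%N) &
      forall i, below L i.+1 -> F (sigma (mkseq s i.+1)) (s i.+1)].

Definition is_least (P : set nat) (j : nat) : Prop := P j /\ lbound P j.

(* ind_s (s i) = j *)
Definition special_index (s : nat -> c00 R) (i j : nat) : Prop :=
  if i is i'.+1 then j = sigma (mkseq s i'.+1)
  else is_least [set k | F k (s 0%N)] j.

(* [x] is a finitely supported special functional, and [I] is its index set for
   some representation of [x] by a special sequence and a finite interval *)
Definition special_functional (x : c00 R) (I : set nat) : Prop :=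
  exists (s : nat -> c00 R) (L : option nat) (a b : nat),
    [/\ special s L,
        forall n, x n = if n \in `[a, b] then \sum_(i \in below L) s i n else 0 &
        I = [set j | exists i, [/\ below L i, restr `[a, b] (s i) != 0 &
                                   special_index s i j]]].

(* [x] is an element of one of the F_j, 1 <= j, used as a single functional; the
   index set of 0 is empty *)
Definition single_functional (x : c00 R) (I : set nat) : Prop :=
  Fpos x /\
  I = [set j | x != 0 /\ is_least [set k | (1 <= k)%N /\ F k x] j].

(* The d functionals [x k] are admissible: they belong to the union of the
   special functionals and of the F_j, 1 <= j, have pairwise disjoint index sets
   for some choice of representations, and d <= min supp (x k). *)
Definition admissible (d : nat) (x : 'I_d -> c00 R) : Prop :=
  (exists I : 'I_d -> set nat,
    (forall k, special_functional (x k) (I k) \/ single_functional (x k) (I k))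
    /\ trivIset [set: 'I_d] I) /\
  (forall k, supp_from d (x k)).

Definition F2s : set (c00 R) :=
  F 0%N `|`
  [set f | exists (d : nat) (a : 'I_d -> rat) (x : 'I_d -> c00 R),
    [/\ (0 < d)%N, \sum_k a k ^+ 2 <= 1, admissible x &
        f = \sum_k ratr (a k) *: x k]].

Definition Fs : set (c00 R) :=
  F 0%N `|`
  [set f | exists (d : nat) (e : 'I_d -> bool) (x : 'I_d -> c00 R),
    [/\ (0 < d)%N, admissible x & f = \sum_k (-1) ^+ e k *: x k]].

End JTG.

Section Banach.
Variable R : realType.

(* [X], with the canonical map [iota], is the completion of c00 for the norm
   sup {f x : f in G}; it is unique up to a linear isometry. *)
Definition completion_for (G : set (c00 R)) (X : completeNormedModType R)
    (iota : {linear c00 R -> X}) : Prop :=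
  (forall x, (`|iota x|)%:E = act_sup G x) /\ dense (range iota).

Definition closed_subspace (X : normedModType R) (A : set X) : Prop :=
  [/\ A 0, forall (a : R) x y, A x -> A y -> A (a *: x + y) & closed A].

Definition infinite_dim (X : normedModType R) (A : set X) : Prop :=
  ~ exists (n : nat) (v : 'I_n -> X),
      forall x, A x -> exists c : 'I_n -> R, x = \sum_i c i *: v i.

Definition opnorm (V W : normedModType R) (A : set V) (T : V -> W) : \bar R :=
  ereal_sup [set `|T v|%:E | v in A `&` [set v | `|v| <= 1]].

(* There is an isomorphism [T] of the subspace [A] onto the subspace [B], with
   inverse [S], such that ||T|| ||S|| <= C. *)
Definition isomorphic_within (C : R) (V W : normedModType R)
    (A : set V) (B : set W) : Prop :=
  exists (T : V -> W) (S : W -> V),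
    [/\ forall (a : R) x y, A x -> A y -> T (a *: x + y) = a *: T x + T y,
        set_fun A B T /\ set_fun B A S,
        (forall x, A x -> S (T x) = x) /\ (forall y, B y -> T (S y) = y),
        (opnorm A T < +oo)%E /\ (opnorm B S < +oo)%E &
        (opnorm A T * opnorm B S <= C%:E)%E].

Definition c0_pred : {pred nat -> R^o} :=
  mem [set u : nat -> R^o | u @ \oo --> (0 : R^o)].

Record c0 := C0 { c0_val :> nat -> R^o; _ : c0_val \in c0_pred }.

HB.instance Definition _ := [isSub for c0_val].
HB.instance Definition _ := [Choice of c0 by <:].

Lemma c0_submod_closed : submod_closed c0_pred.
Proof.
split; first by apply: mem_set; exact: cvg_cst.
move=> a u v /set_mem/= cu /set_mem/= cv; apply: mem_set => /=.
rewrite -[X in _ --> X]addr0 -[X in _ --> X + _](scaler0 _ a).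
by apply: cvgD => //; exact: cvgZr.
Qed.

HB.instance Definition _ :=
  GRing.isSubmodClosed.Build _ _ c0_pred c0_submod_closed.
HB.instance Definition _ := [SubChoice_isSubLmodule of c0 by <:].

Definition c0_norm (u : c0) : R := sup [set `|u n| | n in [set: nat]].

Lemma c0_norm_has_sup (u : c0) : has_sup [set `|u n| | n in [set: nat]].
Proof.
split; first by exists `|u 0%N|, 0%N.
case: u => u /= /set_mem/= cu.
have /cvg_seq_bounded/pinfty_ex_gt0[M _ /= uM] : cvgn u by apply/cvg_ex; exists 0.
by exists M => _ [n _ <-]; exact: uM.
Qed.

Lemma c0_norm_ub (u : c0) n : `|u n| <= c0_norm u.
Proof. by apply: ub_le_sup; [case: (c0_norm_has_sup u) | exists n]. Qed.

Lemma c0_norm_le (u : c0) M : (forall n, `|u n| <= M) -> c0_norm u <= M.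
Proof.
move=> uM; apply: ge_sup; first by case: (c0_norm_has_sup u).
by move=> _ [n _ <-].
Qed.

Lemma c0_normD (u v : c0) : c0_norm (u + v) <= c0_norm u + c0_norm v.
Proof.
apply: c0_norm_le => n.
by apply: le_trans (ler_normD (u n) (v n)) _; apply: lerD; exact: c0_norm_ub.
Qed.

Lemma c0_normZ (a : R) (u : c0) : c0_norm (a *: u) = `|a| * c0_norm u.
Proof.
have le b w : c0_norm (b *: w) <= `|b| * c0_norm w.
  apply: c0_norm_le => n; rewrite [X in `|X|](_ : _ = b * w n)// normrM.
  by apply: ler_wpM2l => //; exact: c0_norm_ub.
apply/eqP; rewrite eq_le le /=; have [->|a0] := eqVneq a 0.
  rewrite normr0 mul0r; apply: le_trans (c0_norm_ub _ 0%N); exact: normr_ge0.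
have := le a^-1 (a *: u).
by rewrite scalerA mulVf// scale1r normfV mulrC ler_pdivlMr ?normr_gt0// mulrC.
Qed.

Lemma c0_norm0_eq0 (u : c0) : c0_norm u = 0 -> u = 0.
Proof.
move=> u0; apply/val_inj/funext => n.
by apply/eqP; rewrite -normr_le0 -u0; exact: c0_norm_ub.
Qed.

HB.instance Definition _ :=
  Lmodule_isNormed.Build R c0 c0_normD c0_normZ c0_norm0_eq0.

End Banach.

(* Main.v *)
Require Import Defs.
From mathcomp Require Import ring lra zify.

(** A functional of the norming set built from d elementary functionals (special
    functionals or members of some F_j, j >= 1) vanishes before d. Hence a
    normalized block sequence on which the elementary functionals become small
    fast enough is almost isometrically the basis of c_0: a norming functional
    fails to be small on at most one of its terms.

    So it suffices to find, in every block subspace, normalized vectors on which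
    all elementary functionals are small. Otherwise, condition (C) and the
    summability of the tau_j give a block sequence u_k, normed by elementary
    functionals, each u_k being seen by the F_j only for j in a window, with
    disjoint windows. The norming functionals of n^2 terms are then admissible,
    so any signed sum of n^2 terms has norm at least of the order of n. On the
    other hand, special functionals large on u_k with distinct pasts have
    disjoint indices, so only boundedly many pasts occur at each k. Passing to a
    limit along an ultrafilter one may assume that the value of the i-th past at
    u_k', acting on u_k with k < k', hardly depends on k and k'. Then all
    elementary functionals are bounded on alternating sums, a contradiction. *)

Set Implicit Arguments.
Unset Strict Implicit.
Unset Printing Implicit Defensive.

(** * Finitely supported sequences: supports and the pairing [act] *)

Section C00Theory.
Variable R : realType.
Implicit Types (f g x y : c00 R) (N n : nat).

(** The obstacle is that one special functional may be large on many terms of a block sequence.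
    Before the last term on which it is large, it acts essentially through its past there, since its
    other members have indices in later windows. The past takes nearly the same value on all these
    terms, so alternating signs cancel it up to a single value, whatever the number of terms. The
    lower estimate for n^2 terms is only of order n because their norming functionals enter with
    weights 1/n, rational and of square sum 1. This suffices: if no good vector exists, then by
    homogeneity some elementary functional exceeds eps times the norm of the alternating sum, a
    quantity that grows with n, while the upper estimate is an absolute constant. The error per term
    must be of order 1/n^2, so n is fixed before the block sequence is built. Vectors of Y need not
    be finitely supported. Coordinates are therefore extended to the completion, and a gliding hump
    replaces Y by a block sequence close to it. *)

Lemma c00N x n : (- x) n = - x n :> R. Proof. by []. Qed.

Lemma c00_sum (I : Type) (r : seq I) (P : pred I) (F : I -> c00 R) n :
  (\sum_(i <- r | P i) F i) n = \sum_(i <- r | P i) (F i n : R) :> R.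
Proof. exact: (big_morph (fun x : c00 R => x n : R) (fun=> fun=> erefl) erefl). Qed.

Lemma c00P x y : (forall n, x n = y n :> R) -> x = y.
Proof. by move=> xy; apply/val_inj/funext => n; exact: xy. Qed.

Lemma c00_neq0 x : x != 0 -> exists n, x n != 0.
Proof.
move=> x0; apply: contrapT => h; move/eqP: x0; apply; apply: c00P => n.
by apply/eqP; apply: contra_notT h => xn; exists n.
Qed.

Lemma c00_neq0P x n : x n != 0 -> x != 0.
Proof. by apply: contraNneq => ->. Qed.

Definition supp_ge N x := forall n, x n != 0 -> (N <= n)%N.
Definition supp_lt N x := forall n, x n != 0 -> (n < N)%N.

Lemma c00_supp_lt x : exists N, supp_lt N x.
Proof.
have /set_mem/= := valP x; rewrite /= => /finite_seqP[s hs].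
exists (\max_(i <- s) i).+1 => n xn; rewrite ltnS.
have : [set n | val x n != 0] n by [].
by rewrite hs /= => ns; rewrite (big_rem n ns) /= leq_max leqnn.
Qed.

Lemma supp_ltW N M x : (N <= M)%N -> supp_lt N x -> supp_lt M x.
Proof. by move=> NM h n /h /leq_trans; apply. Qed.

Lemma supp_geW N M x : (N <= M)%N -> supp_ge M x -> supp_ge N x.
Proof. by move=> NM h n /h; apply: leq_trans. Qed.

Lemma supp_geD N x y : supp_ge N x -> supp_ge N y -> supp_ge N (x + y).
Proof.
move=> hx hy n; case: (eqVneq (x n) 0) => [x0|/hx//].
case: (eqVneq (y n) 0) => [y0|/hy//].
by rewrite [X in X != _](_ : _ = x n + y n)// x0 y0 addr0 eqxx.
Qed.

Lemma supp_geZ N a x : supp_ge N x -> supp_ge N (a *: x).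
Proof.
move=> hx n h; apply: hx; apply: contra h => /eqP h.
by rewrite [X in X == _](_ : _ = a * x n)// h mulr0.
Qed.

Lemma supp_ge0 N : supp_ge N 0.
Proof. by move=> n; rewrite [X in X != _](_ : _ = 0)// eqxx. Qed.

Lemma supp_ge_sum N (I : Type) (r : seq I) (P : pred I) (F : I -> c00 R) :
  (forall i, P i -> supp_ge N (F i)) -> supp_ge N (\sum_(i <- r | P i) F i).
Proof.
by move=> h; apply: big_ind => //; [exact: supp_ge0 | exact: supp_geD].
Qed.

Lemma supp_ltD N x y : supp_lt N x -> supp_lt N y -> supp_lt N (x + y).
Proof.
move=> hx hy n; case: (eqVneq (x n) 0) => [x0|/hx//].
case: (eqVneq (y n) 0) => [y0|/hy//].
by rewrite [X in X != _](_ : _ = x n + y n)// x0 y0 addr0 eqxx.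
Qed.

Lemma supp_ltZ N a x : supp_lt N x -> supp_lt N (a *: x).
Proof.
move=> hx n h; apply: hx; apply: contra h => /eqP h.
by rewrite [X in X == _](_ : _ = a * x n)// h mulr0.
Qed.

Lemma supp_ltNge N x n : supp_lt N x -> (N <= n)%N -> x n = 0.
Proof. by move=> h Nn; apply/eqP; apply: contraTT Nn => /h; rewrite -ltnNge. Qed.

Lemma supp_geNlt N x n : supp_ge N x -> (n < N)%N -> x n = 0.
Proof. by move=> h Nn; apply/eqP; apply: contraTT Nn => /h; rewrite -leqNgt. Qed.

Lemma actE N f x : supp_lt N x -> act f x = \sum_(n < N) (f n : R) * x n.
Proof.
move=> h; rewrite /act (fsbig_ord _ _ (fun n => (f n : R) * x n)).
apply/esym/fsbig_widen => // n [_ /=/negP].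
by rewrite -leqNgt => /(supp_ltNge h) ->; rewrite mulr0.
Qed.

Lemma actDr f x y : act f (x + y) = act f x + act f y.
Proof.
have [N hx] := c00_supp_lt x; have [M hy] := c00_supp_lt y.
pose K := maxn N M.
have hx' : supp_lt K x := supp_ltW (leq_maxl _ _) hx.
have hy' : supp_lt K y := supp_ltW (leq_maxr _ _) hy.
rewrite (actE _ hx') (actE _ hy') (actE _ (supp_ltD hx' hy')) -big_split /=.
by apply: eq_bigr => i _; rewrite -mulrDr.
Qed.

Lemma actZr f a x : act f (a *: x) = a * act f x.
Proof.
have [N hx] := c00_supp_lt x.
rewrite (actE _ hx) (actE _ (@supp_ltZ _ a _ hx)) big_distrr /=.
by apply: eq_bigr => i _; rewrite mulrCA.
Qed.

Lemma actDl f g x : act (f + g) x = act f x + act g x.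
Proof.
have [N hx] := c00_supp_lt x.
rewrite !(actE _ hx) -big_split /=.
by apply: eq_bigr => i _; rewrite -mulrDl.
Qed.

Lemma actZl f a x : act (a *: f) x = a * act f x.
Proof.
have [N hx] := c00_supp_lt x.
rewrite !(actE _ hx) big_distrr /=.
by apply: eq_bigr => i _; rewrite mulrA.
Qed.

Lemma act0l x : act 0 x = 0.
Proof. by rewrite -(scale0r 0) actZl mul0r. Qed.
Lemma act0r f : act f 0 = 0.
Proof. by rewrite -(scale0r 0) actZr mul0r. Qed.
Lemma actNl f x : act (- f) x = - act f x.
Proof. by rewrite -scaleN1r actZl mulN1r. Qed.
Lemma actNr f x : act f (- x) = - act f x.
Proof. by rewrite -scaleN1r actZr mulN1r. Qed.
Lemma actBl f g x : act (f - g) x = act f x - act g x.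
Proof. by rewrite actDl actNl. Qed.
Lemma actBr f x y : act f (x - y) = act f x - act f y.
Proof. by rewrite actDr actNr. Qed.

Lemma act_suml (I : Type) (r : seq I) (P : pred I) (F : I -> c00 R) x :
  act (\sum_(i <- r | P i) F i) x = \sum_(i <- r | P i) act (F i) x.
Proof.
exact: (big_morph (fun f => act f x) (fun f g => actDl f g x) (act0l x)).
Qed.

Lemma act_sumr (I : Type) (r : seq I) (P : pred I) (F : I -> c00 R) f :
  act f (\sum_(i <- r | P i) F i) = \sum_(i <- r | P i) act f (F i).
Proof.
exact: (big_morph (fun x => act f x) (fun x y => actDr f x y) (act0r f)).
Qed.

Lemma eq_act f g x : (forall n, x n != 0 -> f n = g n) -> act f x = act g x.
Proof.
move=> h; have [N hx] := c00_supp_lt x; rewrite !(actE _ hx).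
apply: eq_bigr => i _; have [->|/h->//] := eqVneq (x i) 0.
by rewrite !mulr0.
Qed.

Lemma act_disj f x : (forall n, x n != 0 -> f n = 0) -> act f x = 0.
Proof. by move=> h; rewrite (@eq_act f 0) ?act0l. Qed.

Lemma act_neq0 f x : act f x != 0 -> exists n, f n != 0 /\ x n != 0.
Proof.
move=> h; apply: contrapT => h'; move/eqP: h; apply; apply: act_disj => n xn.
by apply/eqP; apply: contra_notT h' => fn; exists n.
Qed.

Lemma restrE a b f n :
  restr `[a, b] f n = (if (a <= n <= b)%N then f n else 0) :> R.
Proof. by rewrite /= in_itv /=. Qed.

Lemma act_restr a b f x : (forall n, x n != 0 -> (a <= n <= b)%N) ->
  act (restr `[a, b] f) x = act f x.
Proof. by move=> h; apply: eq_act => n /h ab; rewrite restrE ab. Qed.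

Lemma act_unitvec k x : act (unitvec k) x = x k.
Proof.
have [N hx] := c00_supp_lt x.
have hx' := supp_ltW (leq_addr k.+1 N) hx.
have kN : (k < N + k.+1)%N by rewrite addnS ltnS leq_addl.
rewrite (actE _ hx') (bigD1 (Ordinal kN)) //= eqxx mul1r big1 ?addr0 // => i.
by rewrite -val_eqE /= => /negbTE ->; rewrite mul0r.
Qed.

Definition l1norm x : R := \sum_(n < projT1 (cid (c00_supp_lt x))) `|x n : R|.

Lemma l1norm_ge0 x : 0 <= l1norm x.
Proof. by apply: sumr_ge0. Qed.

Lemma le_act_l1norm f x (c : R) :
  (forall n, `|f n| <= c) -> `|act f x| <= c * l1norm x.
Proof.
rewrite /l1norm; case: cid => N /= hx fc; rewrite (actE _ hx) big_distrr /=.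
by apply: (le_trans (ler_norm_sum _ _ _)); apply: ler_sum => i _; rewrite normrM ler_wpM2r.
Qed.

End C00Theory.

(** * Consequences of the JTG axioms *)

Lemma sum_reindex_lt (R : realType) (e : nat -> R) (g : nat -> nat) n :
  (forall j, 0 <= e j) -> (forall i j, (i < j < n)%N -> (g i < g j)%N) ->
  exists M, \sum_(i < n) e (g i) <= \sum_(0 <= j < M) e j.
Proof.
move=> e0; case: n => [|n] gi; first by exists 0%N; rewrite big_ord0 big_geq.
exists (g n).+1; elim: n gi => [|n IH] gi.
  rewrite big_ord1 big_nat_recr //= lerDr; exact: sumr_ge0.
rewrite big_ord_recr /= [leRHS]big_nat_recr //= lerD2r.
apply: le_trans (IH _) _ => [i j ijn|]; first by apply: gi; lia.
have lt : ((g n).+1 <= g n.+1)%N by apply: gi; lia.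
rewrite [leRHS](big_cat_nat _ (n := (g n).+1)) //= lerDl; exact: sumr_ge0.
Qed.

Lemma dep_choice (T : Type) (Q : nat -> T -> T -> Prop) (t0 : T) :
  (forall n t, exists t', Q n t t') ->
  exists f : nat -> T, f 0%N = t0 /\ forall n, Q n (f n) (f n.+1).
Proof.
move=> h.
pose C n t := projT1 (cid (h n t)).
have CP n t : Q n t (C n t) by rewrite /C; case: cid.
pose f := fix f n := if n is n'.+1 then C n' (f n') else t0.
by exists f; split => // n; exact: CP.
Qed.

Section JTGTheory.
Variables (R : realType) (F : nat -> set (c00 R)).
Hypothesis hF : JTG F.

Lemma F0P f : F 0%N f -> exists n, f = unitvec n \/ f = - unitvec n.
Proof. by case: hF => -> _ _ _ _. Qed.

Lemma F0_unitvec n : F 0%N (unitvec n).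
Proof. by case: hF => -> _ _ _ _; exists n; left. Qed.

Lemma F_opp j f : F j f -> F j (- f).
Proof.
case: j => [|j]; last by case: hF => _ /(_ j.+1 isT)[_ _ h _ _] _ _ _; exact: h.
case: hF => -> _ _ _ _ [n [->|->]]; exists n; first by right.
by left; rewrite opprK.
Qed.

Lemma F_restr j f E : (1 <= j)%N -> F j f -> F j (restr E f).
Proof. by move=> j1; case: hF => _ /(_ j j1)[_ _ _ _ h] _ _ _; exact: h. Qed.

Lemma F_nonempty j : exists f, F j f.
Proof.
case: j => [|j]; first by exists (unitvec 0); exact: F0_unitvec.
by case: hF => _ /(_ j.+1 isT)[[f Ff] _ _ _ _] _ _ _; exists f.
Qed.

Lemma restr_unitvec a b n :
  restr `[a, b] (unitvec n : c00 R) = if (a <= n <= b)%N then unitvec n else 0.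
Proof.
apply: c00P => m; rewrite restrE; have [->|mn] := eqVneq m n.
  by case: ifP.
by case: ifP; case: ifP => //=; rewrite (negbTE mn).
Qed.

Lemma restrN (f : c00 R) a b : restr `[a, b] (- f) = - restr `[a, b] f.
Proof. by apply: c00P => m; rewrite [RHS]c00N !restrE; case: ifP; rewrite ?oppr0. Qed.

(** A restricted unit vector may be 0, which is not in [F 0]. Allowing 0 lets the index 0 be treated
    like the others. *)
Lemma F_restr0 j f a b : F j f \/ f = 0 -> F j (restr `[a, b] f) \/ restr `[a, b] f = 0.
Proof.
case=> [Ff|->]; last by right; apply: c00P => n; rewrite restrE; case: ifP.
case: j Ff => [|j] Ff; last by left; exact: F_restr.
have [n [->|->]] := F0P Ff.
  by rewrite restr_unitvec; case: ifP; [left; exact: F0_unitvec|right].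
rewrite restrN restr_unitvec; case: ifP; last by right; rewrite oppr0.
by left; apply: F_opp; exact: F0_unitvec.
Qed.

Definition Finf (f : c00 R) := exists i, F i f.

Let t j : R := fine (tau F j).

Lemma tau_ge0 j : (0 <= tau F j)%E.
Proof.
have [f Ff] := F_nonempty j.
apply: (le_trans _ (ereal_sup_ubound (x := supnorm f) _)); last by exists f.
apply: (le_trans _ (ereal_sup_ubound (x := `|f 0%N|%:E) _)); last by exists 0%N.
by rewrite lee_fin.
Qed.

Lemma tau_sum_le1 M : (\sum_(1 <= j < M) tau F j <= 1)%E.
Proof.
case: hF => _ _ _ h _; apply: le_trans h.
by apply: nneseries_lim_ge => j _ _; exact: tau_ge0.
Qed.

Lemma tau_fin j : (1 <= j)%N -> tau F j = (t j)%:E.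
Proof.
move=> j1; rewrite /t fineK // ge0_fin_numE ?tau_ge0 //.
apply: (le_lt_trans _ (ltry 1)); apply: le_trans (tau_sum_le1 j.+1).
rewrite big_nat_recr //= leeDr // sume_ge0 // => i _; exact: tau_ge0.
Qed.

Lemma t_ge0 j : 0 <= t j.
Proof. by rewrite /t fine_ge0 // tau_ge0. Qed.

Lemma le_coord_t j f n : (1 <= j)%N -> F j f -> `|f n| <= t j.
Proof.
move=> j1 Ff; rewrite -lee_fin -tau_fin //.
apply: (le_trans _ (ereal_sup_ubound (x := supnorm f) _)); last by exists f.
by apply: ereal_sup_ubound; exists n.
Qed.

Lemma t_sum_le1 M : \sum_(1 <= j < M) t j <= 1.
Proof.
rewrite -lee_fin -sumEFin; apply: le_trans (tau_sum_le1 M).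
rewrite le_eqVlt; apply/orP; left; apply/eqP.
by apply: eq_big_nat => i /andP[i1 _]; rewrite tau_fin.
Qed.

Lemma t_tail J (eta : R) : 0 < eta ->
  exists2 J', (J < J')%N & forall M, \sum_(J' <= j < M) t j <= eta.
Proof.
move=> eta0.
pose A := [set \sum_(1 <= j < M) t j | M in [set: nat]].
have hA : has_sup A.
  split; first by exists (\sum_(1 <= j < 0) t j), 0%N.
  by exists 1 => _ [M _ <-]; exact: t_sum_le1.
have [_ [M0 _ <-] hM0] := sup_adherent eta0 hA.
exists (maxn M0 J).+1 => [|M]; first lia.
have [le|lt] := leqP M (maxn M0 J).+1.
  by rewrite big_geq //; exact: ltW.
have : \sum_(1 <= j < M) t j <= sup A.
  by apply: sup_upper_bound => //; exists M.
rewrite (big_cat_nat _ (n := (maxn M0 J).+1)) //=; last exact: ltnW.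
have : \sum_(1 <= j < M0) t j <= \sum_(1 <= j < (maxn M0 J).+1) t j.
  have [M00|M00] := leqP 1 M0; last first.
    by rewrite big_geq ?sumr_ge0 // => [i _|]; [exact: t_ge0 | lia].
  rewrite [leRHS](big_cat_nat _ (n := M0)) //=; last lia.
  by rewrite lerDl sumr_ge0 // => i _; exact: t_ge0.
lra.
Qed.

(* [u] is seen, up to [delta], only by the F_j with J <= j < J'. *)
Definition window (J J' : nat) (delta : R) (u : c00 R) :=
  forall n (f : nat -> c00 R) (g : nat -> nat),
  (forall i, (i < n)%N -> F (g i) (f i) \/ f i = 0) ->
  (forall i j, (i < j < n)%N -> (g i < g j)%N) ->
  (forall i, (i < n)%N -> ~~ (J <= g i < J')%N) ->
  \sum_(i < n) `|act (f i) u| <= delta.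

(** Below [J] there are only [J] indices, each costing at most delta / 2 / (J + 1). From [J'] on,
    members of F_j have coordinates at most tau_j, and a tail of the sum of the tau_j is small
    against the l_1 norm of [u]. Each side costs delta / 2. *)
Lemma windowP J (delta : R) u : 0 < delta ->
  (forall j f, (j < J)%N -> F j f -> `|act f u| <= delta / 2 / J.+1%:R) ->
  exists2 J', (J < J')%N & window J J' delta u.
Proof.
move=> d0 hu; pose l := l1norm u + 1.
have l0 : 0 < l by rewrite /l ltr_wpDl ?l1norm_ge0.
have [J' JJ' hJ'] := @t_tail J (delta / 2 / l) ltac:(by rewrite !divr_gt0).
exists J' => // n f g Ff gi gw.
(* A majorant of the action of F_j on [u] for the indices that can occur; it is 0 in the window,
   where no index is taken. *)
pose e j : R := if (j < J)%N then delta / 2 / J.+1%:R else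
  if (j < J')%N then 0 else t j * l.
have e0 j : 0 <= e j.
  rewrite /e; case: ifP => _; first by rewrite !divr_ge0 ?ltW.
  by case: ifP => _ //; rewrite mulr_ge0 ?t_ge0 ?ltW.
have [M hM] := sum_reindex_lt e0 gi.
apply: (@le_trans _ _ (\sum_(i < n) e (g i))).
  apply: ler_sum => i _; have [Fi|->] := Ff i (ltn_ord i); last by rewrite act0l normr0.
  rewrite /e; case: ifP => [lt|/negbT]; first exact: hu Fi.
  rewrite -leqNgt => ge; have := gw i (ltn_ord i); rewrite ge /= => /negbTE ->.
  (* Outside the window and not below [J], the index is at least [J'], hence positive as
     [le_coord_t] requires. *)
  have g1 : (1 <= g i)%N by have := gw i (ltn_ord i); lia.
  apply: le_trans (le_act_l1norm _ (fun n => le_coord_t n g1 Fi)) _.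
  by rewrite ler_wpM2l ?t_ge0 // /l lerDl.
apply: (le_trans hM).
apply: (@le_trans _ _ (\sum_(0 <= j < J' + M) e j)).
  rewrite [leRHS](big_cat_nat _ (n := M)) ?leq_addl //= lerDl sumr_ge0 //.
rewrite (big_cat_nat _ (n := J')) ?leq_addr //= (big_cat_nat _ (n := J)) ?(ltnW JJ') //=.
have -> : \sum_(J <= j < J') e j = 0.
  by rewrite big_nat big1 // => j /andP[a b]; rewrite /e ltnNge a b.
have -> : \sum_(0 <= j < J) e j = J%:R * (delta / 2 / J.+1%:R).
  under eq_big_nat => j /andP[_ a] do rewrite /e a.
  by rewrite sumr_const_nat subn0 mulr_natl.
have -> : \sum_(J' <= j < J' + M) e j = (\sum_(J' <= j < J' + M) t j) * l.
  rewrite mulr_suml; apply: eq_big_nat => j /andP[a _]; rewrite /e.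
  by rewrite ltnNge (leq_trans (ltnW JJ') a) /= ltnNge a.
have h1 : (\sum_(J' <= j < J' + M) t j) * l <= delta / 2.
  by rewrite -ler_pdivlMr.
have h2 : J%:R * (delta / 2 / J.+1%:R) <= delta / 2.
  rewrite mulrCA ler_piMr ?divr_ge0 ?(ltW d0) //.
  by rewrite ler_pdivrMr ?ltr0n // mul1r ler_nat.
by rewrite addr0 [leRHS](splitr delta) lerD.
Qed.

End JTGTheory.

(** * Special functionals *)

Section Special.
Variables (R : realType) (F : nat -> set (c00 R)) (hF : JTG F).
Variables (Xi1 Xi2 : set nat) (sigma : seq (c00 R) -> nat).
Hypothesis hsigma : coding F Xi1 Xi2 sigma.

Lemma special_sub s L N : special F Xi1 sigma s L -> (0 < N)%N ->
  below (Some N) `<=` below L -> special F Xi1 sigma s (Some N).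
Proof.
case=> [L0 [bl1 bl2] pos first next] N0 sub; split => //.
- by split=> [i /sub|i j /sub Li /sub Lj]; [exact: bl1 | exact: bl2].
- by move=> i /sub; exact: pos.
- by move=> i /sub; exact: next.
Qed.

(** [special_index] as a function. For a special sequence the default 0 of [xget] is not reached,
    since the first term lies in some F_j. *)
Definition idx (s : nat -> c00 R) i :=
  if i is i'.+1 then sigma (mkseq s i'.+1)
  else xget 0%N [set j | is_least [set k | F k (s 0%N)] j].

Lemma is_least_ex (P : set nat) : P !=set0 -> exists j, is_least P j.
Proof.
case=> k Pk.
have ex : exists k, `[< P k >] by exists k; apply/asboolP.
have [j /asboolP Pj jmin] := ex_minnP ex.
by exists j; split => // i Pi; apply: jmin; apply/asboolP.
Qed.

Lemma is_least_uniq (P : set nat) i j : is_least P i -> is_least P j -> i = j.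
Proof.
move=> [Pi li] [Pj lj]; have := li _ Pj; have := lj _ Pi; rewrite !leEnat; lia.
Qed.

Section Finite.
Variables (s : nat -> c00 R) (N : nat).
Hypothesis sp : special F Xi1 sigma s (Some N).

Lemma special_gt0 : (0 < N)%N. Proof. by case: sp. Qed.

Lemma special_neq0 i : (i < N)%N -> s i != 0.
Proof. by case: sp => _ [h _] _ _ _ iN; exact: h. Qed.

Lemma special_precedes i j : (i < j < N)%N -> precedes (s i) (s j).
Proof.
by case: sp => _ [_ h] _ _ _ /andP[ij jN]; apply: h => //=; exact: ltn_trans jN.
Qed.

Lemma special_Fpos i : (i < N)%N -> Fpos F (s i).
Proof. by case: sp => _ _ h _ _ iN; exact: h. Qed.

Lemma idx0P : is_least [set k | F k (s 0%N)] (idx s 0).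
Proof.
rewrite /idx; case: xgetP => [j _ //|].
have [j _ Fj] := special_Fpos special_gt0.
by have [k hk] := @is_least_ex [set k | F k (s 0%N)] (ex_intro _ j Fj) => /(_ k).
Qed.

Lemma special_indexP i j : special_index F sigma s i j <-> j = idx s i.
Proof.
case: i => [|i] //=; split => [h|->]; last exact: idx0P.
exact: is_least_uniq h idx0P.
Qed.

Lemma F_idx i : (i < N)%N -> F (idx s i) (s i).
Proof.
case: i => [_|i iN]; first by have [] := idx0P.
by case: sp => _ _ _ _; exact.
Qed.

Lemma block_tuple_mkseq j : (0 < j <= N)%N -> block_tuple F (mkseq s j).
Proof.
move=> /andP[j0 jN]; split.
- by move=> /(congr1 size); rewrite size_mkseq => j0'; rewrite j0' in j0.
- rewrite size_mkseq; split=> [i|i k] /= ij; first rewrite nth_mkseq //.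
    by apply: special_neq0; exact: leq_trans jN.
  move=> kj ik; rewrite !nth_mkseq //; apply: special_precedes.
  by rewrite ik (leq_trans kj).
- move=> f /mapP[i]; rewrite mem_iota add0n => /andP[_ ij] ->.
  by apply: special_Fpos; exact: leq_trans jN.
Qed.

Lemma idx_lt i j : (i < j < N)%N -> (idx s i < idx s j)%N.
Proof.
case: j => [|j] /andP[ij jN]; first by [].
have [_ _ _ _ h] := hsigma.
apply: (h (mkseq s j.+1)); first by apply: block_tuple_mkseq; exact: ltnW.
  by apply/mapP; exists i => //; rewrite mem_iota.
by apply: F_idx; exact: ltn_trans jN.
Qed.

End Finite.

(** From the second term on, an index is the code of the preceding terms, and injectivity of [sigma]
    recovers them. The index of a first term codes nothing, whence 0 < i and 0 < i'. *)
Lemma idx_inj s N s' N' i i' :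
  special F Xi1 sigma s (Some N) -> special F Xi1 sigma s' (Some N') ->
  (0 < i < N)%N -> (0 < i' < N')%N -> idx s i = idx s' i' ->
  i = i' /\ mkseq s i = mkseq s' i.
Proof.
move=> sp sp' iN iN'; have [_ _ _ [_ inj] _] := hsigma.
case: i iN => [//|i] iN; case: i' iN' => [//|i'] iN' /= e.
have : mkseq s i.+1 = mkseq s' i'.+1.
  apply: inj e; rewrite inE.
    by apply: (block_tuple_mkseq sp); case/andP: iN => ? /ltnW.
  by apply: (block_tuple_mkseq sp'); case/andP: iN' => ? /ltnW.
move=> h; have := congr1 size h; rewrite !size_mkseq => ii'.
by split=> //; rewrite h ii'.
Qed.

(** Normal form of a special functional. The restriction is inside the sum, so that every summand is
    0 or again a member of its F_j. *)
Definition spf (s : nat -> c00 R) N a b := \sum_(i < N) restr `[a, b] (s i).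

Lemma block_ge (s : nat -> c00 R) L i n : block_on (below L) s -> below L i -> s i n != 0 -> (i <= n)%N.
Proof.
move=> [ne pr]; elim: i n => [//|i IH] n Li sn.
have Li' : below L i by case: L Li {ne pr IH} => //= l; exact: ltnW.
have [m sm] := c00_neq0 (ne _ Li').
exact: leq_ltn_trans (IH _ Li' sm) (pr _ _ Li' Li (ltnSn i) _ _ sm sn).
Qed.

(** The i-th term of a block sequence vanishes before coordinate i, so an interval ending at b meets
    only the terms with i <= b, and even an infinite special sequence can be cut to b + 1 terms. *)
Lemma special_functionalP x I : special_functional F Xi1 sigma x I ->
  exists s N a b, special F Xi1 sigma s (Some N) /\ x = spf s N a b.
Proof.
case=> s [L] [a] [b] [sp hx _].
have [L0 bl _ _ _] := sp.
pose N := if L is Some l then minn l b.+1 else b.+1.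
have NP i : (i < N)%N <-> below L i /\ (i <= b)%N.
  by rewrite /N; case: (L) => [l|] /=; [rewrite leq_min ltnS; split=> [/andP//|[-> ->]]|rewrite ltnS; tauto].
have N0 : (0 < N)%N by apply/NP.
have sub : below (Some N) `<=` below L by move=> i /= /NP[].
exists s, N, a, b; split; first exact: special_sub sp N0 sub.
apply: c00P => n; rewrite hx in_itv /= /spf c00_sum.
rewrite (eq_bigr _ (fun (i : 'I_N) _ => restrE a b (s i) n)).
case: ifP => [/andP[_ nb]|_]; last by rewrite big1.
rewrite (fsbig_ord _ _ (fun i => s i n : R)); apply/esym/fsbig_widen => //.
move=> i [Li /= niN]; apply/eqP; apply: contra_notT niN => sin.
by apply/NP; split=> //; exact: leq_trans (block_ge bl Li sin) nb.
Qed.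

Lemma special_functional_spf s N a b : special F Xi1 sigma s (Some N) ->
  special_functional F Xi1 sigma (spf s N a b)
    [set j | exists2 i, (i < N)%N & restr `[a, b] (s i) != 0 /\ j = idx s i].
Proof.
move=> sp; exists s, (Some N), a, b; split=> //.
  move=> n; rewrite /spf c00_sum in_itv /=.
  rewrite (eq_bigr _ (fun (i : 'I_N) _ => restrE a b (s i) n)).
  case: ifP => _; last by rewrite big1.
  by rewrite (fsbig_ord _ _ (fun i => s i n : R)).
apply/seteqP; split=> j /=.
  by move=> [i iN [ri ->]]; exists i; split => //; apply/(special_indexP sp).
by move=> [i [iN ri /(special_indexP sp) ->]]; exists i.
Qed.

Lemma act_spf s N a b x : act (spf s N a b) x = \sum_(i < N) act (restr `[a, b] (s i)) x.
Proof. exact: act_suml. Qed.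

Lemma spf_supp s N a b n : spf s N a b n != 0 -> (a <= n <= b)%N.
Proof.
apply: contraTT => h; rewrite negbK; apply/eqP.
by rewrite /spf c00_sum big1 // => i _; rewrite restrE (negbTE h).
Qed.

(* Truncating a special functional to the window: the functionals of index
   below [J] are cut off by raising the left end of the interval to the beginning
   of the support of the first remaining one. *)
Lemma special_window s N a b J J' (delta : R) lo hi u :
  special F Xi1 sigma s (Some N) -> window F J J' delta u ->
  supp_ge lo u -> supp_lt hi u -> delta < `|act (spf s N a b) u| ->
  exists x I, [/\ special_functional F Xi1 sigma x I,
    I `<=` [set j | (J <= j < J')%N /\ exists2 i, (i < N)%N & j = idx s i],
    supp_ge lo x, supp_lt hi x &
    `|act (spf s N a b) u| - delta <= `|act x u|].
Proof.
move=> sp win ulo uhi big.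
pose w i := (J <= idx s i < J')%N.
(* The positions with index outside the window, listed increasingly, form a family to which [win]
   applies. *)
have win_out : `|\sum_(i < N | ~~ w i) act (restr `[a, b] (s i)) u| <= delta.
  apply: le_trans (ler_norm_sum _ _ _) _; rewrite big_mkcond /=.
  pose l := [seq i <- iota 0 N | ~~ w i].
  have -> : \sum_(i < N) (if ~~ w i then `|act (restr `[a, b] (s i)) u| else 0) =
    \sum_(i < size l) `|act (restr `[a, b] (s (nth 0%N l i))) u|.
    rewrite -(big_mkord xpredT (fun i => if ~~ w i then `|act (restr `[a, b] (s i)) u| else 0)).
    rewrite -big_mkcond -[LHS]big_filter /index_iota subn0.
    by rewrite (big_nth 0%N) big_mkord.
  have lN i : (i < size l)%N -> (nth 0%N l i < N)%N /\ ~~ w (nth 0%N l i).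
    by move/(mem_nth 0%N); rewrite mem_filter mem_iota => /andP[].
  have lsorted : sorted ltn l by apply: sorted_filter; [exact: ltn_trans | exact: iota_ltn_sorted].
  apply: (win _ (fun i => restr `[a, b] (s (nth 0%N l i))) (fun i => idx s (nth 0%N l i))).
  - by move=> i /lN[iN _]; apply: F_restr0 => //; left; exact: (F_idx sp iN).
  - move=> i j /andP[ij jl]; apply: (idx_lt sp); rewrite (proj1 (lN _ jl)) andbT.
    by apply: (sorted_ltn_nth ltn_trans) => //; rewrite inE //; exact: ltn_trans jl.
  - by move=> i /lN[].
have act_split : act (spf s N a b) u = \sum_(i < N | w i) act (restr `[a, b] (s i)) u +
   \sum_(i < N | ~~ w i) act (restr `[a, b] (s i)) u.
  by rewrite act_spf (bigID (fun i : 'I_N => w i)).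
have : exists i, (i < N)%N && w i.
  apply: contrapT => h; move: big; rewrite act_split big1 ?add0r; first by rewrite ltNge win_out.
  by move=> i wi; exfalso; apply: h; exists i; rewrite ltn_ord.
(* Indices increase along [s], so the positions with index in the window are exactly p <= i < q. *)
move=> exw; have [p /andP[pN wp] pmin] := ex_minnP exw.
have exq : exists q, (q <= N)%N && [forall i : 'I_N, w i ==> (i < q)%N].
  by exists N; rewrite leqnn /=; apply/forallP => i; rewrite ltn_ord implybT.
have [q /andP[qN /forallP qw] qmin] := ex_minnP exq.
have pq : (p < q)%N by have := qw (Ordinal pN); rewrite /= wp.
have wq i : (p <= i < q)%N -> w i.
  move=> /andP[pi iq]; have q0 : (0 < q)%N by exact: leq_ltn_trans pq.
  have wq1 : w q.-1.
    apply/negPn/negP => nw; have := qmin q.-1; rewrite (leq_trans (leq_pred q) qN) /=.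
    have -> : [forall i : 'I_N, w i ==> (i < q.-1)%N].
      apply/forallP => k; apply/implyP => wk; have := qw k; rewrite wk /= => kq.
      have : nat_of_ord k != q.-1 by apply: contraNneq nw => <-.
      lia.
    by move=> /(_ isT); lia.
  have mono k l : (k <= l < N)%N -> (idx s k <= idx s l)%N.
    rewrite leq_eqVlt => /andP[/orP[/eqP->//|kl] lN].
    by apply: ltnW; apply: (idx_lt sp); rewrite kl.
  move: wp wq1; rewrite /w => /andP[J1 _] /andP[_ J2].
  apply/andP; split; first by apply: (leq_trans J1); apply: mono; lia.
  by apply: (leq_ltn_trans _ J2); apply: mono; lia.
have exn : exists n, s p n != 0 by apply: c00_neq0; exact: (special_neq0 sp pN).
have [n0 sn0 n0min] := ex_minnP exn.
have spq : special F Xi1 sigma s (Some q).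
  by apply: (special_sub sp) => [|i /= iq]; [exact: leq_ltn_trans pq | exact: leq_trans qN].
(* Starting at the minimum [n0] of the support of [s p] erases the terms before [p]; those from [q]
   on are removed by shortening the sequence. The interval is closed and [hi] is a strict bound,
   hence [hi.-1]. *)
pose a' := maxn (maxn a n0) lo; pose b' := minn b hi.-1.
have hi0 n : u n != 0 -> (n <= hi.-1)%N by move/uhi; lia.
have sn i n : (i < N)%N -> s i n != 0 -> ((n0 <= n) = (p <= i))%N.
  move=> iN sin; have [pi|ip] := leqP p i.
    move: pi; rewrite leq_eqVlt => /orP[/eqP e|pi]; first by rewrite e in n0min; rewrite n0min.
    by apply: ltnW; apply: (special_precedes sp _ sn0 sin); rewrite pi.
  apply/negbTE; rewrite -ltnNge.
  by apply: (special_precedes sp _ sin sn0); rewrite ip.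
have restr_eq i : (i < q)%N -> act (restr `[a', b'] (s i)) u =
   if w i then act (restr `[a, b] (s i)) u else 0.
  move=> iq; have iN : (i < N)%N by exact: leq_trans qN.
  have -> : w i = (p <= i)%N.
    by apply/idP/idP => [wi|pi]; [apply: pmin; rewrite iN | apply: wq; rewrite pi].
  case: ifPn => pi.
    apply: eq_act => n un; rewrite !restrE /a' /b'.
    have [->|sin] := eqVneq (s i n) 0; first by do 2 case: ifP.
    by rewrite !geq_max leq_min (ulo _ un) (hi0 _ un) (sn i n iN sin) pi !andbT.
  apply: act_disj => n un; rewrite restrE /a'.
  have [->|sin] := eqVneq (s i n) 0; first by case: ifP.
  by rewrite !geq_max (sn i n iN sin) (negbTE pi) andbF.
exists (spf s q a' b'), [set j | exists2 i, (i < q)%N & restr `[a', b'] (s i) != 0 /\ j = idx s i].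
split.
- exact: special_functional_spf.
- move=> j /= [i iq [ri ->]]; have iN : (i < N)%N by exact: leq_trans qN.
  split; last by exists i.
  apply: wq; rewrite iq andbT; have [n] := c00_neq0 ri.
  rewrite restrE; case: ifP; last by rewrite eqxx.
  by rewrite /a' !geq_max => /andP[/andP[/andP[_ nn] _] _] sin; rewrite -(sn i n iN sin).
- by move=> n /spf_supp; rewrite /a' !geq_max => /andP[/andP[]].
(* A point in the support of [u] shows that [hi] is positive, so that [hi.-1] is below [hi]. *)
- have [n [_ un]] := @act_neq0 _ (spf s N a b) u ltac:(rewrite -normr_gt0; apply: le_lt_trans big; exact: le_trans win_out).
  have h := uhi _ un; move=> m /spf_supp; rewrite /b' leq_min => /andP[_ /andP[_]]; lia.
- have -> : act (spf s q a' b') u = \sum_(i < N | w i) act (restr `[a, b] (s i)) u.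
    rewrite act_spf; under eq_bigr => i _ do rewrite restr_eq //.
    rewrite -big_mkcond /= (big_ord_widen_cond N (fun i => w i) (fun i => act (restr `[a, b] (s i)) u)) //.
    by apply: eq_bigl => i; have := qw i; case: (w i) => //= ->.
  rewrite act_split lerBlDr; apply: le_trans (ler_normD _ _) _.
  by rewrite lerD2l.
Qed.

End Special.

(** * The norming set *)

Section Norm.
Variables (R : realType) (F : nat -> set (c00 R)) (hF : JTG F).
Variables (Xi1 : set nat) (sigma : seq (c00 R) -> nat).
Variable G : set (c00 R).
Hypothesis hG : G = F2s F Xi1 sigma \/ G = Fs F Xi1 sigma.
Variables (X : completeNormedModType R) (iota : {linear c00 R -> X}).
Hypothesis hX : completion_for G iota.

Definition elementary (x : c00 R) :=
  (exists I, special_functional F Xi1 sigma x I) \/ Fpos F x.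

Lemma G_act_le f x : G f -> act f x <= `|iota x|.
Proof.
move=> Gf; rewrite -lee_fin (proj1 hX x); apply: ereal_sup_ubound.
by exists f.
Qed.

Lemma G_act_norm_le f x : G f -> `|act f x| <= `|iota x|.
Proof.
move=> Gf; rewrite ler_norml G_act_le // andbT lerNl -actNr.
by rewrite -[leRHS]normrN -raddfN G_act_le.
Qed.

Lemma G_act_gt x (delta : R) : 0 < delta ->
  exists2 f, G f & `|iota x| - delta < act f x.
Proof.
move=> d0.
have : ((`|iota x| - delta)%:E < act_sup G x)%E.
  by rewrite -(proj1 hX x) lte_fin ltrBlDr ltrDl.
rewrite /act_sup => /ereal_sup_gt[_ [f Gf <-]]; rewrite lte_fin => h.
by exists f.
Qed.

Lemma G_F0 f : F 0%N f -> G f.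
Proof. by case: hG => -> ?; left. Qed.

Lemma coord_le (x : c00 R) n : `|x n : R| <= `|iota x|.
Proof. by rewrite -act_unitvec; apply: G_act_norm_le; apply: G_F0; exact: F0_unitvec. Qed.

(** The number of functionals is a square so that the equal weights 1/m are rational with square sum
    1, as [F2s] asks. In [Fs] the weights are 1, which gives an even better bound. *)
Lemma admissible_norm m x y : (0 < m)%N -> @admissible _ F Xi1 sigma (m * m) x ->
  (\sum_k `|act (x k) y|) / m%:R <= `|iota y|.
Proof.
move=> m0 ad; pose e k := (act (x k) y < 0).
have eE k : `|act (x k) y| = (-1) ^+ e k * act (x k) y.
  by rewrite /e; apply: normrEsign; exact: num_real.
case: hG => GE.
  have m0R : (m%:R : rat) != 0 by rewrite pnatr_eq0 -lt0n.
  have : G (\sum_k ratr ((-1) ^+ e k / m%:R) *: x k).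
    rewrite GE; right.
    exists (m * m)%N, (fun k => (-1) ^+ e k / m%:R), x; split=> //.
      by rewrite muln_gt0 m0.
    under eq_bigr do rewrite exprMn sqrr_sign mul1r.
    by rewrite sumr_const card_ord -[leLHS]mulr_natr exprVn natrM -expr2 mulVf // expf_neq0.
  move=> /(G_act_le y); rewrite act_suml; apply: le_trans.
  rewrite mulr_suml; apply: ler_sum => k _.
  rewrite actZl rmorphM /= fmorphV /= ratr_nat rmorphXn /= rmorphN1 eE.
  by rewrite mulrAC.
have : G (\sum_k (-1) ^+ e k *: x k).
  rewrite GE; right; exists (m * m)%N, e, x; split=> //.
  by rewrite muln_gt0 m0.
move=> /(G_act_le y); rewrite act_suml; apply: le_trans.
under [leRHS]eq_bigr do rewrite actZl -eE.
by rewrite ler_piMr ?sumr_ge0 // invf_le1 ?ltr0n // ler1n.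
Qed.

Lemma Fpos_single f : Fpos F f -> exists I, single_functional F f I.
Proof. by move=> Ff; eexists; split; [exact: Ff | reflexivity]. Qed.

(** The case m = 1, where the support condition is void because coordinates are counted from 1. *)
Lemma elementary_le x y : elementary x -> `|act x y| <= `|iota y|.
Proof.
move=> ex; have := @admissible_norm 1 (fun=> x) y isT.
rewrite divr1 muln1 big_ord1; apply; split=> [|_ n _ //].
have [I hI] : exists I, special_functional F Xi1 sigma x I \/ single_functional F x I.
  case: ex => [[I hI]|/Fpos_single[I hI]]; first by exists I; left.
  by exists I; right.
by exists (fun=> I); split=> // i j _ _ _; rewrite !ord1.
Qed.

Lemma Finf_le f y : Finf F f -> `|act f y| <= `|iota y|.
Proof.
move=> [[|j] Ff]; first by apply: G_act_norm_le; exact: G_F0.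
by apply: elementary_le; right; exists j.+1.
Qed.

Lemma ler_norm_ratr d (a : 'I_d -> rat) k : \sum_k a k ^+ 2 <= 1 -> `|ratr (a k) : R| <= 1.
Proof.
move=> h; rewrite -ratr_norm -(rmorph1 (@ratr R)) ler_rat.
rewrite -(@expr_le1 _ 2) // real_normK ?num_real //; apply: le_trans h.
by rewrite (bigD1 k) //= lerDl sumr_ge0 // => i _; exact: sqr_ge0.
Qed.

(** A common shape of both norming sets, keeping what the upper estimates use: d elementary
    functionals starting at d or later, with coefficients at most 1. *)
Lemma G_form f : G f -> F 0%N f \/ exists d (a : 'I_d -> R) (x : 'I_d -> c00 R),
  [/\ forall k, `|a k| <= 1, forall k, elementary (x k), forall k, supp_from d (x k) &
   f = \sum_k a k *: x k].
Proof.
have ad d x : @admissible _ F Xi1 sigma d x -> (forall k, elementary (x k)) /\ forall k, supp_from d (x k).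
  case=> [[I [hI _]] hd]; split=> // k; case: (hI k) => h.
    by left; exists (I k).
  by right; case: h.
case: hG => -> [F0f|]; try by left.
  move=> [d [a [x [_ a1 /ad[h1 h2] ->]]]]; right.
  by exists d, (fun k => ratr (a k)), x; split => // k; exact: ler_norm_ratr a1.
move=> [d [e [x [_ /ad[h1 h2] ->]]]]; right.
by exists d, (fun k => (-1) ^+ e k), x; split => // k; rewrite normr_sign.
Qed.

End Norm.

(** * Block sequences with disjoint windows *)

Section Blocks.
Variable R : realType.
Implicit Types (x : nat -> c00 R) (V : set (c00 R)) (b : nat -> nat).

Definition blocks b x := forall k,
  [/\ x k != 0, supp_ge (b k) (x k) & supp_lt (b k.+1) (x k)].

Lemma blocks_ltS b x k : blocks b x -> (b k < b k.+1)%N.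
Proof.
by move=> /(_ k)[/c00_neq0[n xn] ge lt]; exact: leq_ltn_trans (ge _ xn) (lt _ xn).
Qed.

Lemma blocks_mono b x k l : blocks b x -> (k <= l)%N -> (b k <= b l)%N.
Proof.
move=> bx; elim: l => [|l IH]; first by rewrite leqn0 => /eqP ->.
rewrite leq_eqVlt => /orP[/eqP->//|kl].
by apply: leq_trans (IH kl) (ltnW (blocks_ltS l bx)).
Qed.

Lemma blocks_ge b x k : blocks b x -> (k <= b k)%N.
Proof.
move=> bx; elim: k => // k IH; exact: leq_ltn_trans IH (blocks_ltS k bx).
Qed.

Lemma blocks_disj b x i k n : blocks b x -> i != k -> (b k <= n < b k.+1)%N -> x i n = 0.
Proof.
move=> bx; rewrite neq_ltn => /orP[ik|ki] /andP[h1 h2]; have [_ ge lt] := bx i.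
  apply: (supp_ltNge lt); apply: leq_trans h1; exact: (blocks_mono bx).
by apply: (supp_geNlt ge); apply: (leq_trans h2); exact: (blocks_mono bx).
Qed.

Lemma blocks_in b x k n : blocks b x -> x k n != 0 -> (b k <= n < b k.+1)%N.
Proof. by move=> /(_ k)[_ ge lt] xn; rewrite ge // lt. Qed.

Lemma blocks_block_on b x : blocks b x -> block_on [set: nat] x.
Proof.
move=> bx; split=> [i _|i j _ _ ij m n xm xn]; first by case: (bx i).
have /andP[_ h1] := blocks_in bx xm; have /andP[h2 _] := blocks_in bx xn.
by apply: (leq_trans h1); apply: leq_trans h2; exact: (blocks_mono bx).
Qed.

(** What is kept of a block subspace: it holds for the span of a block sequence, passes to the
    vectors supported beyond a given point, and suffices to extract block sequences, hence to apply
    condition (C) inside [V]. *)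
Definition rich V := [/\ V 0, forall (a : R) y z, V y -> V z -> V (a *: y + z) &
  forall N, exists v, [/\ V v, v != 0 & supp_ge N v]].

Lemma richZ V (a : R) y : rich V -> V y -> V (a *: y).
Proof. by move=> [V0 VL _] Vy; rewrite -[_ *: _]addr0; exact: VL. Qed.

Lemma subspace_sum (W : lmodType R) (V : set W) n (a : nat -> R) (y : nat -> W) :
  V 0 -> (forall (c : R) y z, V y -> V z -> V (c *: y + z)) ->
  (forall k, (k < n)%N -> V (y k)) -> V (\sum_(k < n) a k *: y k).
Proof.
move=> V0 VL; elim: n => [|n IH] h; first by rewrite big_ord0.
rewrite big_ord_recr /= addrC; apply: VL; first exact: h.
by apply: IH => k kn; apply: h; exact: ltnW.
Qed.

Lemma span_of_ofE (W : lmodType R) (z : nat -> W) (n m : nat) (a : nat -> R) : (n <= m)%N ->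
  \sum_(k < n) a k *: z k = \sum_(k < m) (if (k < n)%N then a k else 0) *: z k.
Proof.
move=> nm; rewrite (big_ord_widen m (fun k => a k *: z k)) // big_mkcond /=.
by apply: eq_bigr => i _; case: ifP => _ //; rewrite scale0r.
Qed.

Lemma blocks_rich b x : blocks b x -> rich (span_of x).
Proof.
move=> bx; split.
- by exists 0%N, (fun=> 0); rewrite big_ord0.
- move=> c _ _ [n [a ->]] [m [a' ->]]; exists (maxn n m).
  exists (fun k => c * (if (k < n)%N then a k else 0) + if (k < m)%N then a' k else 0).
  rewrite (span_of_ofE x a (leq_maxl n m)) (span_of_ofE x a' (leq_maxr n m)).
  rewrite scaler_sumr -big_split /=; apply: eq_bigr => i _.
  by rewrite scalerDl scalerA.
- move=> N; exists (x N); split; last 2 first.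
  + by case: (bx N).
  + by have [_ h _] := bx N; exact: supp_geW (blocks_ge N bx) h.
  exists N.+1, (fun k => (k == N)%:R); rewrite big_ord_recr /= eqxx scale1r big1 ?add0r // => i _.
  by rewrite (ltn_eqF (ltn_ord i)) scale0r.
Qed.

Lemma blocks_exist (P : nat -> c00 R -> Prop) :
  (forall k N, exists v, [/\ v != 0, supp_ge N v & P k v]) ->
  exists b x, blocks b x /\ forall k, P k (x k).
Proof.
move=> h.
pose Q k (s s' : nat * c00 R) :=
  [/\ s'.2 != 0, supp_ge s.1 s'.2, P k s'.2 & supp_lt s'.1 s'.2].
have [|f [_ fQ]] := @dep_choice (nat * c00 R) Q (0%N, 0).
  move=> k [N u]; have [v [v0 vN Pv]] := h k N.
  by have [N' vN'] := c00_supp_lt v; exists (N', v).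
exists (fun k => (f k).1), (fun k => (f k.+1).2).
by split=> k; have [? ? ? ?] := fQ k.
Qed.

Lemma geom_sum_le1 n : \sum_(k < n) (2 ^- k.+1 : R) <= 1.
Proof.
suff -> : \sum_(k < n) (2 ^- k.+1 : R) = 1 - 2 ^- n by rewrite gerBl invr_ge0 exprn_ge0.
elim: n => [|n IH]; first by rewrite big_ord0 expr0 invr1 subrr.
rewrite big_ord_recr /= IH exprS; have : (2 : R) ^+ n != 0 by rewrite expf_neq0.
by move=> h; field.
Qed.

End Blocks.

(** * Normalized block sequences with successive windows, from condition (C) *)

Section RIS.
Variables (R : realType) (F : nat -> set (c00 R)) (hF : JTG F).
Variables (Xi1 : set nat) (sigma : seq (c00 R) -> nat).
Variable G : set (c00 R).
Hypothesis hG : G = F2s F Xi1 sigma \/ G = Fs F Xi1 sigma.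
Variables (X : completeNormedModType R) (iota : {linear c00 R -> X}).
Hypothesis hX : completion_for G iota.

Lemma JTG_small V N j (delta : R) : rich V -> 0 < delta ->
  exists y, [/\ V y, supp_ge N y, exists2 g, Finf F g & act g y = 1,
    forall f, Finf F f -> `|act f y| <= 2 & forall f, F j f -> `|act f y| <= delta].
Proof.
move=> rV d0; have [V0 VL Vr] := rV.
have [|b [x [bx Px]]] := @blocks_exist R (fun _ v => V v /\ supp_ge N v).
  move=> _ M; have [v [Vv v0 vM]] := Vr (maxn M N).
  by exists v; split=> //; [exact: supp_geW (leq_maxl _ _) vM | split=> //; exact: supp_geW (leq_maxr _ _) vM].
have [_ _ _ _ /(_ x (blocks_block_on bx) j delta d0)[y [n [a yE]] ylt]] := hF.
have Vy : V y by rewrite yE; exact: (subspace_sum (n := n) a V0 VL (fun k _ => proj1 (Px k))).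
have yN : supp_ge N y.
  by rewrite yE; apply: supp_ge_sum => k _; apply: supp_geZ; case: (Px k).
have Fj0 : (0 <= act_sup (F j) y)%E.
  have [f Ff] := F_nonempty hF j.
  have [h|h] := leP 0 (act f y).
    apply: (@le_trans _ _ (act f y)%:E); first by rewrite lee_fin.
    by apply: ereal_sup_ubound; exists f.
  apply: (@le_trans _ _ (act (- f) y)%:E); first by rewrite lee_fin actNl oppr_ge0 ltW.
  by apply: ereal_sup_ubound; exists (- f) => //; exact: (F_opp hF).
(* The norm of the completion dominates all the F_i, so both suprema are finite and can be handled
   as reals. *)
have AM : (act_sup (\bigcup_i F i) y <= (`|iota y|)%:E)%E.
  apply: ge_ereal_sup => _ [f [i _ Ff] <-]; rewrite lee_fin.
  by apply: (le_trans (ler_norm _)); apply: (Finf_le hG hX); exists i.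
have A0 : (0 <= act_sup (\bigcup_i F i) y)%E.
  apply: le_trans Fj0 _; apply: le_ereal_sup => _ [f Ff <-]; exists f => //; by exists j.
have mA : (act_sup (F j) y <= act_sup (\bigcup_i F i) y)%E.
  by apply: le_ereal_sup => _ [f Ff <-]; exists f => //; exists j.
have AE : act_sup (\bigcup_i F i) y = (fine (act_sup (\bigcup_i F i) y))%:E.
  by rewrite fineK // ge0_fin_numE // (le_lt_trans AM) // ltry.
have mE : act_sup (F j) y = (fine (act_sup (F j) y))%:E.
  by rewrite fineK // ge0_fin_numE // (le_lt_trans mA) // (le_lt_trans AM) // ltry.
set M := fine _ in AE; set m := fine _ in mE.
have m0 : 0 <= m by rewrite /m fine_ge0.
have mM : m < delta * M by rewrite -lte_fin EFinM -mE -AE.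
have M0 : 0 < M by rewrite -(pmulr_rgt0 _ d0); exact: le_lt_trans mM.
have Finf_act f : Finf F f -> `|act f y| <= M.
  move=> [i Ff]; rewrite ler_norml lerNl -actNl -!lee_fin -AE; apply/andP; split.
    by apply: ereal_sup_ubound; exists (- f) => //; exists i => //; exact: (F_opp hF).
  by apply: ereal_sup_ubound; exists f => //; exists i.
have Fj_act f : F j f -> `|act f y| <= m.
  move=> Ff; rewrite ler_norml lerNl -actNl -!lee_fin -mE; apply/andP; split.
    by apply: ereal_sup_ubound; exists (- f) => //; exact: (F_opp hF).
  by apply: ereal_sup_ubound; exists f.
(* [g] exceeds half of the supremum, which yields the bound 2 after division by [act g y], and
   exceeds m / delta, which yields the bound delta on F_j. *)
have : ((Num.max (M / 2) (m / delta))%:E < act_sup (\bigcup_i F i) y)%E.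
  rewrite AE lte_fin gt_max ltr_pdivrMr // ltr_pMr // ltr1n /=.
  by rewrite ltr_pdivrMr // mulrC.
rewrite /act_sup => /ereal_sup_gt[_ [g [i _ Fg] <-]].
rewrite lte_fin gt_max => /andP[g1 g2].
have g0 : 0 < act g y by apply: le_lt_trans g1; rewrite divr_ge0 // ltW.
exists ((act g y)^-1 *: y); split.
- exact: richZ.
- exact: supp_geZ.
- by exists g; [exists i | rewrite actZr mulVf // gt_eqF].
- move=> f Ff; rewrite actZr normrM normfV (gtr0_norm g0) ler_pdivrMl //.
  apply: le_trans (Finf_act f Ff) _; move: g1; rewrite ltr_pdivrMr //; exact: ltW.
- move=> f Ff; rewrite actZr normrM normfV (gtr0_norm g0) ler_pdivrMl //.
  by apply: le_trans (Fj_act f Ff) _; move: g2; rewrite ltr_pdivrMr // => /ltW.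
Qed.

(** Condition (C) controls one F_j at a time. For the index [J] it is applied in the span of blocks
    on which the smaller indices are already small at a geometric rate; the new vector has
    coefficients at most 2 on these blocks, so it inherits their smallness. *)
Lemma JTG_small_below J V N (delta : R) : rich V -> 0 < delta ->
  exists y, [/\ V y, supp_ge N y, exists2 g, Finf F g & act g y = 1,
    forall f, Finf F f -> `|act f y| <= 2 &
    forall j f, (j < J)%N -> F j f -> `|act f y| <= delta].
Proof.
elim: J V N delta => [|J IH] V N delta rV d0.
  by have [y [? ? ? ? _]] := JTG_small N 0 rV d0; exists y.
have [V0 VL _] := rV.
pose P k v := [/\ V v, supp_ge N v, exists2 g, Finf F g & act g v = 1 &
  forall j f, (j < J)%N -> F j f -> `|act f v| <= delta / 2 * 2 ^- k.+1].
have [|b [x [bx Px]]] := @blocks_exist R P.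
  move=> k M; have [||y [Vy yM [g Fg gy] _ yJ]] := IH V (maxn M N) (delta / 2 * 2 ^- k.+1) => //.
    by rewrite mulr_gt0 ?divr_gt0 // invr_gt0 exprn_gt0.
  exists y; split; last split=> //.
  - by apply: contra_eq_neq gy => ->; rewrite act0r eq_sym oner_neq0.
  - exact: supp_geW (leq_maxl _ _) yM.
  - exact: supp_geW (leq_maxr _ _) yM.
  - by exists g.
have [y [[n [a yE]] yN gy y2 yJ]] := JTG_small N J (blocks_rich bx) d0.
exists y; split=> //.
  rewrite yE; apply: (subspace_sum (n := n) a V0 VL (y := x)) => k _.
  by case: (Px k).
move=> j f; rewrite ltnS leq_eqVlt => /orP[/eqP->|jJ] Ff; first exact: yJ.
have a2 k : (k < n)%N -> `|a k| <= 2.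
  move=> kn; have [_ _ [g [i Fg] gx] _] := Px k.
  (* Restricted to the k-th block, the functional with value 1 on [x k] remains in its F_i and reads
     off the coefficient [a k]. *)
  pose g' := restr `[b k, (b k.+1).-1] g.
  have g'x l : act g' (x l) = (l == k)%:R.
    have [->|lk] := eqVneq l k.
      rewrite /g' act_restr // => m /(blocks_in bx); lia.
    apply: act_disj => m xm; rewrite restrE; case: ifP => // h.
    have : (b k <= m < b k.+1)%N by have := blocks_ltS k bx; lia.
    by move/(blocks_disj bx lk)/eqP; rewrite (negbTE xm).
  have -> : a k = act g' y.
    rewrite yE act_sumr (bigD1 (Ordinal kn)) //= actZr g'x eqxx mulr1 big1 ?addr0 //.
    by move=> l; rewrite -val_eqE /= actZr g'x => /negbTE ->; rewrite mulr0.
  apply: y2; exists i; have [//|g'0] := F_restr0 hF (b k) (b k.+1).-1 (or_introl Fg).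
  by have := g'x k; rewrite /g' g'0 act0l eqxx => /eqP; rewrite eq_sym oner_eq0.
rewrite yE act_sumr; apply: le_trans (ler_norm_sum _ _ _) _.
apply: (@le_trans _ _ (\sum_(k < n) delta * 2 ^- k.+1)).
  apply: ler_sum => k _; rewrite actZr normrM.
  have -> : delta * 2 ^- k.+1 = 2 * (delta / 2 * 2 ^- k.+1) by rewrite mulrA; congr (_ * _); field.
  apply: ler_pM => //; first exact: a2.
  by have [_ _ _ Pk] := Px k; exact: (Pk j f jJ Ff).
by rewrite -mulr_sumr -[leRHS]mulr1 ler_wpM2l ?(ltW d0) // geom_sum_le1.
Qed.

Lemma ris_exist V (delta : R) : rich V -> 0 < delta ->
  exists b u J, [/\ blocks b u, forall k, V (u k), forall k, `|iota (u k)| = 1,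
    forall k, (J k < J k.+1)%N & forall k, window F (J k) (J k.+1) delta (u k)].
Proof.
move=> rV d0.
pose T := (nat * c00 R * nat)%type.
pose Q (k : nat) (s s' : T) := let: (N, _, J) := s in let: (N', u, J') := s' in
  [/\ V u, `|iota u| = 1, supp_ge N u /\ supp_lt N' u, (J < J')%N & window F J J' delta u].
have [|f [_ fQ]] := @dep_choice T Q (0%N, 0, 0%N).
  move=> k [[N u] J].
  have [|y [Vy yN [g Fg gy] _ yJ]] := @JTG_small_below J V N (delta / 2 / J.+1%:R) rV.
    by rewrite !divr_gt0.
  (* Since the norm is at least 1, normalizing [y] does not increase the values of functionals. *)
  have y1 : 1 <= `|iota y|.
    by have := Finf_le hG hX y Fg; rewrite gy normr1.
  have y0 : 0 < `|iota y| by apply: lt_le_trans y1.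
  pose v := `|iota y|^-1 *: y.
  have [N' vN'] := c00_supp_lt v.
  have [|J' JJ' win] := @windowP _ _ hF J delta v d0.
    move=> j h jJ Fh; rewrite actZr normrM normfV normr_id.
    apply: (le_trans _ (yJ j h jJ Fh)).
    by rewrite ler_piMl // invf_le1.
  exists (N', v, J'); split=> //; first exact: richZ.
    by rewrite linearZ normrZ normfV normr_id mulVf // gt_eqF.
  by split=> //; exact: supp_geZ.
exists (fun k => (f k).1.1), (fun k => (f k.+1).1.2), (fun k => (f k).2).
split=> k; have := fQ k; case: (f k) => [[N u] J]; case: (f k.+1) => [[N' u'] J'] /= [] => //.
move=> _ u1 [? ?] _ _; split=> //; apply: contra_eq_neq u1 => ->.
by rewrite linear0 normr0 eq_sym oner_neq0.
Qed.

End RIS.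

(** * Finite covers, ultrafilters and alternating sums *)

Lemma finite_cover (T : eqType) (A : set T) M :
  (forall l : seq T, uniq l -> (forall t, t \in l -> A t) -> (size l < M)%N) ->
  exists2 l : seq T, (size l < M)%N & forall t, A t -> t \in l.
Proof.
move=> h.
have ex : exists m, `[< exists l : seq T, [/\ uniq l, forall t, t \in l -> A t & size l = m] >].
  by exists 0%N; apply/asboolP; exists [::].
have ub m : `[< exists l : seq T, [/\ uniq l, forall t, t \in l -> A t & size l = m] >] -> (m <= M)%N.
  by move=> /asboolP[l [ul lA <-]]; apply: ltnW; exact: h.
have [m /asboolP[l [ul lA sl]] mmax] := ex_maxnP ex ub.
exists l; first exact: h.
move=> t At; apply/negPn/negP => tl.
suff /mmax : `[< exists l : seq T, [/\ uniq l, forall t, t \in l -> A t & size l = m.+1] >] by rewrite ltnn.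
apply/asboolP; exists (t :: l); split=> /=; rewrite ?tl ?sl // => t'.
by rewrite inE => /orP[/eqP->//|]; exact: lA.
Qed.

Lemma ultra_lim (R : realType) (U : set_system nat) (phi : nat -> R) :
  UltraFilter U -> (forall n, `|phi n| <= 1) ->
  exists2 r, `|r| <= 1 & forall e, 0 < e -> U [set n | `|phi n - r| <= e].
Proof.
move=> UU phi1.
have hA : (phi @ U) [set` `[-1, 1]].
  have : U [set n | phi n \in `[-1, 1]]; last by [].
  by apply: (filterS _ (@filterT _ U _)) => n _ /=; rewrite in_itv /= -ler_norml; exact: phi1.
have [r [r1 hr]] := @segment_compact R (-1) 1 (phi @ U) _ hA.
exists r; first by move: r1; rewrite /= in_itv /= -ler_norml.
move=> e e0; have [//|Un] := in_ultra_setVsetC [set n | `|phi n - r| <= e] UU.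
have Un' : (phi @ U) (~` [set y | `|y - r| <= e]) by [].
have [y [/= + ry]] := hr _ _ Un' (nbhsx_ballx r e e0).
by move: ry; rewrite /ball /= distrC => /ltW ry /(_ ry).
Qed.

(** Iterated limits along one ultrafilter: [rr i k] is the limit of [H k' i k] in k', and [r i] that
    of [rr i k] in k. Each [kappa m] is drawn from sets of the ultrafilter on which both
    approximations are within e / 2. *)
Lemma ultra_select (R : realType) D K0 (H : nat -> nat -> nat -> R) (e : R) :
  (forall k' i k, `|H k' i k| <= 1) -> 0 < e ->
  exists (kappa : nat -> nat) (r : nat -> R), [/\ forall m, (K0 <= kappa m)%N,
    forall m m', (m < m')%N -> (kappa m < kappa m')%N,
    forall i, `|r i| <= 1 &
    forall m m' i, (m < m')%N -> (i < D)%N -> `|H (kappa m') i (kappa m) - r i| <= e].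
Proof.
move=> H1 e0; have [U [UU ooU]] := ultraFilterLemma eventually_filter.
have /choice[rr rrP] : forall i, exists f : nat -> R, forall k, `|f k| <= 1 /\
    forall e, 0 < e -> U [set k' | `|H k' i k - f k| <= e].
  move=> i; have /choice[f fP] k : exists x, `|x| <= 1 /\
      forall e, 0 < e -> U [set k' | `|H k' i k - x| <= e].
    by have [x x1 hx] := ultra_lim UU (fun k' => H1 k' i k); exists x.
  by exists f.
have /choice[r rP] : forall i, exists x, `|x| <= 1 /\
    forall e, 0 < e -> U [set k | `|rr i k - x| <= e].
  move=> i; have [x x1 hx] := ultra_lim UU (fun k => proj1 (rrP i k)).
  by exists x.
have U_all (P : nat -> nat -> Prop) : (forall i, U [set k | P i k]) ->
    U [set k | forall i, (i < D)%N -> P i k].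
  move=> h; elim: D => [|d IH]; first by apply: (filterS _ (@filterT _ U _)).
  apply: (filterS _ (filterI IH (h d))) => k [h1 h2] i.
  by rewrite ltnS leq_eqVlt => /orP[/eqP->//|]; exact: h1.
pose B := [set k | forall i, (i < D)%N -> `|rr i k - r i| <= e / 2].
pose L k := [set k' | forall i, (i < D)%N -> `|H k' i k - rr i k| <= e / 2].
have e20 : 0 < e / 2 by rewrite divr_gt0.
have UB : U B by apply: U_all => i; exact: (proj2 (rP i)).
have UL k : U (L k) by apply: U_all => i; exact: (proj2 (rrP i k)).
(* A state holds the last number chosen and the set from which later ones are drawn. The premise
   [U s.2] gives every state a successor, as [dep_choice] demands. *)
pose Q (_ : nat) (s s' : nat * set nat) := U s.2 ->
  [/\ U s'.2, s.2 s'.1 /\ B s'.1, (s.1 < s'.1)%N, s'.2 `<=` s.2 & s'.2 `<=` L s'.1].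
have [|f [f0 fQ]] := @dep_choice _ Q (K0, setT).
  move=> n [k S]; rewrite /Q /=; have [US|nUS] := pselect (U S); last by exists (0%N, setT).
  have Uk : U [set k' | (k < k')%N] by apply: ooU; exists k.+1.
  have [k' [[Sk' Bk'] kk']] := filter_ex (filterI (filterI US UB) Uk).
  exists (k', S `&` L k') => _; split=> //=; first exact: filterI.
have fU m : U (f m).2.
  by elim: m => [|m IH]; [rewrite f0; exact: filterT | case: (fQ m IH)].
have fS m m' : (m <= m')%N -> (f m').2 `<=` (f m).2.
  elim: m' => [|m' IH]; first by rewrite leqn0 => /eqP ->.
  rewrite leq_eqVlt => /orP[/eqP->//|/IH h].
  by case: (fQ m' (fU m')) => _ _ _ h' _; exact: subset_trans h' h.
have fS1 m : (f m).2 (f m.+1).1 by case: (fQ m (fU m)) => _ [].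
have fB m : B (f m.+1).1 by case: (fQ m (fU m)) => _ [].
have flt m m' : (m < m')%N -> ((f m).1 < (f m').1)%N.
  have ltS k : ((f k).1 < (f k.+1).1)%N by case: (fQ k (fU k)).
  elim: m' => // m' IH; rewrite ltnS leq_eqVlt => /orP[/eqP->//|/IH h].
  exact: ltn_trans h (ltS _).
exists (fun m => (f m.+1).1), r; split.
- by move=> m; have := flt 0%N m.+1 isT; rewrite f0 => /ltnW.
- by move=> m m' mm'; exact: flt.
- by move=> i; case: (rP i).
move=> m m' i mm' iD; have [_ _ _ _ hL] := fQ m (fU m).
have h1 := hL _ (fS _ _ mm' _ (fS1 m')) i iD; have h2 := fB m i iD.
rewrite (_ : _ - _ = (H (f m'.+1).1 i (f m.+1).1 - rr i (f m.+1).1) + (rr i (f m.+1).1 - r i)); last by ring.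
by apply: le_trans (ler_normD _ _) _; rewrite [leRHS]splitr lerD.
Qed.

(** In the constant 2, one unit pays for the alternating sum of copies of r, which is r or 0, and
    one for the term m0. *)
Lemma alternating_sum_le (R : realType) (B : nat -> R) d m0 (r e : R) :
  (m0 < d)%N -> `|B m0| <= 1 -> `|r| <= 1 -> 0 <= e ->
  (forall m, (m < m0)%N -> `|B m - r| <= e) ->
  (forall m, (m0 < m < d)%N -> `|B m| <= e) ->
  `|\sum_(m < d) (-1) ^+ m * B m| <= 2 + d%:R * e.
Proof.
move=> m0d B1 r1 e0 hlt hgt.
pose E m := if (m < m0)%N then r else 0.
have -> : \sum_(m < d) (-1) ^+ m * B m =
    \sum_(m < d) (-1) ^+ m * E m + \sum_(m < d) (-1) ^+ m * (B m - E m).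
  by rewrite -big_split /=; apply: eq_bigr => m _; ring.
apply: le_trans (ler_normD _ _) _.
have -> : 2 + d%:R * e = 1 + (1 + d%:R * e) by ring.
apply: lerD.
  have -> : \sum_(m < d) (-1) ^+ m * E m = r * \sum_(m < m0) (-1) ^+ m.
    rewrite mulr_sumr (big_ord_widen d (fun m => r * (-1) ^+ m)) ?(ltnW m0d) //.
    rewrite [RHS]big_mkcond /=; apply: eq_bigr => m _; rewrite /E.
    by case: ifP => _; rewrite ?mulr0 // mulrC.
  rewrite normrM; apply: mulr_ile1 => //.
  suff : \sum_(m < m0) (-1) ^+ m = (odd m0)%:R :> R.
    by move=> ->; rewrite ger0_norm ?ler0n // lern1; case: odd.
  elim: m0 {m0d B1 hlt hgt E} => [|k IH]; first by rewrite big_ord0.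
  by rewrite big_ord_recr /= IH -signr_odd; case: (odd k); rewrite /= ?expr1 ?expr0; ring.
apply: le_trans (ler_norm_sum _ _ _) _.
rewrite (bigD1 (Ordinal m0d)) //= normrM normrX normrN1 expr1n mul1r /E ltnn subr0.
apply: lerD => //.
apply: (@le_trans _ _ (\sum_(m < d | m != Ordinal m0d) e)).
  apply: ler_sum => m; rewrite -val_eqE /= neq_ltn normrM normrX normrN1 expr1n mul1r.
  case: ltnP => [mm0 _|]; first exact: hlt.
  by move=> _ /= mm; rewrite subr0; apply: hgt; rewrite mm ltn_ord.
rewrite sumr_const -[e *+ _]mulr_natl ler_wpM2r // ler_nat.
by apply: leq_trans (max_card _) _; rewrite card_ord.
Qed.

(** * Vectors on which the elementary functionals are small *)

Section Core.
Variables (R : realType) (F : nat -> set (c00 R)) (hF : JTG F).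
Variables (Xi1 Xi2 : set nat) (sigma : seq (c00 R) -> nat).
Hypothesis hsigma : coding F Xi1 Xi2 sigma.
Variable G : set (c00 R).
Hypothesis hG : G = F2s F Xi1 sigma \/ G = Fs F Xi1 sigma.
Variables (X : completeNormedModType R) (iota : {linear c00 R -> X}).
Hypothesis hX : completion_for G iota.

Lemma window1 J J' (delta : R) u j f : window F J J' delta u -> F j f \/ f = 0 ->
  ~~ (J <= j < J')%N -> `|act f u| <= delta.
Proof.
move=> win Ff nj; have := win 1%N (fun=> f) (fun=> j).
rewrite big_ord1; apply=> //; lia.
Qed.

Lemma window_ge0 J J' (delta : R) u : window F J J' delta u -> 0 <= delta.
Proof.
by move=> /(_ 0%N (fun=> 0) id); rewrite big_ord0; apply=> // i j; rewrite ltn0 andbF.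
Qed.

(** A special functional is truncated by [special_window]. A member of F_j is restricted to the
    range of [u]; were its least index outside the window, its value on [u] would be at most
    delta. *)
Lemma elementary_window x J J' (delta : R) lo hi u : window F J J' delta u ->
  supp_ge lo u -> supp_lt hi u -> elementary F Xi1 sigma x -> delta < `|act x u| ->
  exists x' I, [/\ special_functional F Xi1 sigma x' I \/ single_functional F x' I,
    I `<=` [set j | (J <= j < J')%N], supp_ge lo x', supp_lt hi x' &
    `|act x u| - delta <= `|act x' u|].
Proof.
move=> win ulo uhi [[I xI]|[j /= j1 Fx]] big.
  have [s [N [a [b [sp xE]]]]] := special_functionalP xI; rewrite {}xE in big *.
  have [x' [I' [h1 h2 h3 h4 h5]]] := special_window hF hsigma sp win ulo uhi big.
  exists x', I'; split=> //; first by left.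
  by move=> k /h2[].
have hi0 n : u n != 0 -> (lo <= n <= hi.-1)%N by move=> un; have := ulo _ un; have := uhi _ un; lia.
pose x' := restr `[lo, hi.-1] x.
have x'u : act x' u = act x u by rewrite /x' act_restr.
have Fx' : F j x' by exact: F_restr.
exists x', [set k | x' != 0 /\ is_least [set k | (1 <= k)%N /\ F k x'] k]; split.
- by right; split=> //; exists j.
- move=> k /= [_ [[k1 Fk] _]]; apply/negPn/negP => nk.
  by have := window1 win (or_introl Fk) nk; rewrite x'u leNgt big.
- by move=> n; rewrite restrE; case: ifP => [/andP[]//|]; rewrite eqxx.
- have [n [_ un]] := @act_neq0 _ x u ltac:(rewrite -normr_gt0; exact: le_lt_trans (window_ge0 win) big).
  have h := uhi _ un; move=> m; rewrite restrE; case: ifP => [mm _|]; [lia | by rewrite eqxx].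
- by rewrite x'u gerBl (window_ge0 win).
Qed.

Section Sequence.
Variables (b : nat -> nat) (u : nat -> c00 R) (J : nat -> nat) (delta : R).
Hypothesis bu : blocks b u.
Hypothesis u1 : forall k, `|iota (u k)| = 1.
Hypothesis J_lt : forall k, (J k < J k.+1)%N.
Hypothesis win : forall k, window F (J k) (J k.+1) delta (u k).

Lemma J_mono k l : (k <= l)%N -> (J k <= J l)%N.
Proof.
elim: l => [|l IH]; first by rewrite leqn0 => /eqP ->.
rewrite leq_eqVlt => /orP[/eqP->//|/IH]; move/leq_trans; apply; exact: ltnW.
Qed.

(** Truncated to their own blocks, the functionals large on the terms have indices in disjoint
    windows and start beyond n^2, so they are admissible; each sees one term of the sum, with value
    at least eps / 2. *)
Lemma ris_lower (eps : R) n (kappa : nat -> nat) (c : nat -> R) :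
  (forall k, exists2 x, elementary F Xi1 sigma x & eps < `|act x (u k)|) ->
  delta <= eps / 2 -> 0 < eps ->
  (0 < n)%N -> (forall m, (n * n <= kappa m)%N) ->
  (forall m m', (m < m')%N -> (kappa m < kappa m')%N) -> (forall m, `|c m| = 1) ->
  n%:R * (eps / 2) <= `|iota (\sum_(m < n * n) c m *: u (kappa m))|.
Proof.
move=> hu de eps0 n0 kn kmono c1.
have /choice[xI xIP] : forall m, exists p : c00 R * set nat,
   [/\ special_functional F Xi1 sigma p.1 p.2 \/ single_functional F p.1 p.2,
    p.2 `<=` [set j | (J (kappa m) <= j < J (kappa m).+1)%N], supp_ge (b (kappa m)) p.1,
    supp_lt (b (kappa m).+1) p.1 & eps / 2 <= `|act p.1 (u (kappa m))|].
  move=> m; have [x ex xu] := hu (kappa m); have [_ lo hi] := bu (kappa m).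
  have dx : delta < `|act x (u (kappa m))| by apply: le_lt_trans xu; lra.
  have [x' [I [h1 h2 h3 h4 h5]]] := elementary_window (@win (kappa m)) lo hi ex dx.
  by exists (x', I); split=> //; apply: le_trans h5; lra.
pose x m := (xI m).1.
pose v := \sum_(m < n * n) c m *: u (kappa m).
have ad : @admissible _ F Xi1 sigma (n * n) (fun m => x m).
  split.
    exists (fun m => (xI m).2); split=> [m|]; first by case: (xIP m).
    have disj (i j : nat) : (i < j)%N -> (xI i).2 `&` (xI j).2 = set0.
      move=> ij; apply/seteqP; split=> // k /= [ki kj].
      have [_ /(_ k ki)/= hi _ _ _] := xIP i; have [_ /(_ k kj)/= hj _ _ _] := xIP j.
      have : (J (kappa i).+1 <= J (kappa j))%N by apply: J_mono; exact: kmono.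
      lia.
    apply/trivIsetP => i j _ _; rewrite -val_eqE /= neq_ltn => /orP[ij|ji]; first exact: disj.
    by rewrite setIC; exact: disj.
  move=> m k xk; have [_ _ lo _ _] := xIP m.
  have := lo _ xk; have := blocks_ge (kappa m) bu; have := kn m; lia.
have := admissible_norm hG hX v n0 ad; apply: le_trans.
rewrite ler_pdivlMr ?ltr0n //.
apply: (@le_trans _ _ (\sum_(m < n * n) eps / 2)).
  by rewrite sumr_const card_ord -[leRHS]mulr_natl natrM; lra.
apply: ler_sum => m _; have [_ _ lo hi xu] := xIP m.
suff -> : `|act (x m) v| = `|act (x m) (u (kappa m))| by [].
rewrite /v act_sumr (bigD1 m) //= actZr big1 ?addr0; first by rewrite normrM c1 mul1r.
move=> l lm; rewrite actZr act_disj ?mulr0 // => k uk.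
apply/eqP; apply: contraT => xk; have h : (b (kappa m) <= k < b (kappa m).+1)%N by rewrite lo // hi.
suff : kappa l != kappa m by move=> /(blocks_disj bu) /(_ h)/eqP; rewrite (negbTE uk).
move: lm; rewrite -val_eqE /= !neq_ltn => /orP[/kmono->//|/kmono->]; exact: orbT.
Qed.

Lemma threshold s N K : special F Xi1 sigma s (Some N) ->
  exists2 p, (p <= N)%N & forall i, (i < N)%N -> (idx F sigma s i < K)%N = (i < p)%N.
Proof.
move=> sp.
have exq : exists q, (q <= N)%N && [forall i : 'I_N, (idx F sigma s i < K)%N ==> (i < q)%N].
  by exists N; rewrite leqnn /=; apply/forallP => i; rewrite ltn_ord implybT.
have [p /andP[pN /forallP qw] pmin] := ex_minnP exq; exists p => // i iN.
apply/idP/idP => [h|ip]; first by have := qw (Ordinal iN); rewrite /= h.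
apply/negPn/negP => nh.
suff : (p <= i)%N by rewrite leqNgt ip.
apply: pmin; rewrite (ltnW iN) /=; apply/forallP => j; apply/implyP => jK.
rewrite ltnNge leq_eqVlt; apply/negP => /orP[/eqP e|ij].
  by move: nh; rewrite e jK.
move: nh; rewrite (ltn_trans _ jK) //; apply: (idx_lt hsigma sp).
by rewrite ij ltn_ord.
Qed.

(** The pasts at [u k]: [p] counts the members with index below the window of [u k]. As p > 0, the
    members in the window come second or later in their sequences, so that their indices are
    codes. *)
Definition histories k (theta : R) := [set t : seq (c00 R) | exists s N e p,
  [/\ special F Xi1 sigma s (Some N), theta <= `|act (spf s N 0 e) (u k)|,
    (0 < p <= N)%N, forall i, (i < N)%N -> (idx F sigma s i < J k)%N = (i < p)%N &
    t = mkseq s p]].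

(* By injectivity of [sigma], special functionals with distinct non-empty histories
   share no index beyond [J k], so that their pieces acting on [u k] are admissible. *)
Lemma histories_finite k (theta : R) n : 0 < theta -> delta <= theta / 3 ->
  2 < n%:R * theta -> (n * n <= k)%N ->
  exists2 l : seq (seq (c00 R)), (size l < n * n)%N & forall t, histories k theta t -> t \in l.
Proof.
move=> th0 dth nth0 nk; apply: finite_cover => l ul lH; rewrite ltnNge; apply/negP => nl.
have n0 : (0 < n)%N by case: (n) nth0 => //; rewrite mul0r; lra.
pose t m := nth [::] l m.
have [_ lo hi] := bu k.
have /choice[xI xIP] : forall m : 'I_(n * n), exists p : c00 R * set nat,
   special_functional F Xi1 sigma p.1 p.2 /\ supp_ge (b k) p.1 /\
   theta / 2 <= `|act p.1 (u k)| /\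
   exists s N p', [/\ special F Xi1 sigma s (Some N), (0 < p' <= N)%N,
    forall i, (i < N)%N -> (idx F sigma s i < J k)%N = (i < p')%N,
    t m = mkseq s p' &
    p.2 `<=` [set j | exists2 i, (p' <= i < N)%N & j = idx F sigma s i]].
  move=> m; have [|s [N [e [p [sp su pN pJ tE]]]]] := lH (t m).
    by apply: mem_nth; exact: leq_trans nl.
  have dx : delta < `|act (spf s N 0 e) (u k)| by apply: lt_le_trans su; lra.
  have [x' [I' [h1 h2 h3 h4 h5]]] := special_window hF hsigma sp (@win k) lo hi dx.
  exists (x', I'); do 3 (split=> //); first by apply: le_trans h5; lra.
  exists s, N, p; split=> // j /h2[/andP[Jj _] [i iN jE]]; exists i => //.
  by rewrite iN andbT leqNgt -pJ // -jE -leqNgt.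
have ad : @admissible _ F Xi1 sigma (n * n) (fun m => (xI m).1).
  split; last first.
    move=> m i xi; have [_ [hlo _]] := xIP m.
    have := hlo _ xi; have := blocks_ge k bu; lia.
  exists (fun m => (xI m).2); split=> [m|]; first by left; case: (xIP m).
  apply/trivIsetP => m m' _ _; apply: contra_neqP => /eqP/set0P[j [/= jm jm']].
  have [_ [_ [_ [s [N [p [sp /andP[p0 pN] pJ tE /(_ _ jm)[i /andP[pi iN] ji]]]]]]]] := xIP m.
  have [_ [_ [_ [s' [N' [p' [sp' /andP[p0' pN'] pJ' tE' /(_ _ jm')[i' /andP[pi' iN'] ji']]]]]]]] := xIP m'.
  have [ii ss] : i = i' /\ mkseq s i = mkseq s' i.
    apply: (idx_inj hsigma sp sp'); last by rewrite -ji.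
      by rewrite iN andbT (leq_trans p0).
    by rewrite iN' andbT (leq_trans p0').
  rewrite -{}ii in pi' iN'.
  have sE q : (q < i)%N -> s q = s' q.
    by move=> qi; have := congr1 (fun t => nth 0 t q) ss; rewrite /= !nth_mkseq.
  have mkE q : (q <= i)%N -> mkseq s q = mkseq s' q.
    move=> qi; apply/eq_in_map => r; rewrite mem_iota add0n /= => rq.
    by apply: sE; exact: leq_trans qi.
  have idxE q : (q < i)%N -> idx F sigma s q = idx F sigma s' q.
    case: q => [|q] qi; last by rewrite /idx mkE // ltnW.
    by rewrite /idx sE.
  (* Both numbers count the indices below [J k] within the common initial segment. *)
  have pp : p = p'.
    case: (ltngtP p p') => // [lt|gt].
      have pi1 : (p < i)%N by exact: leq_trans pi'.
      have := pJ' p (ltn_trans pi1 iN'); rewrite -idxE // pJ ?lt ?ltnn //.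
      exact: ltn_trans iN.
    have pi1 : (p' < i)%N by exact: leq_trans pi.
    have := pJ p' (ltn_trans pi1 iN); rewrite idxE // pJ' ?gt ?ltnn //.
    exact: ltn_trans iN'.
  have := congr1 (index^~ l) (etrans tE (etrans (mkE p pi) (etrans (congr1 (mkseq s') pp) (esym tE')))).
  rewrite /t /= !index_uniq ?(leq_trans _ nl) // => mm.
  exact/val_inj.
(* The norm of [u k] would be at least n * theta / 2, which exceeds 1. *)
have := admissible_norm hG hX (u k) n0 ad.
rewrite u1 ler_pdivrMr ?ltr0n // mul1r leNgt => /negP; apply.
apply: (@lt_le_trans _ _ (\sum_(m < n * n) theta / 2)); last first.
  by apply: ler_sum => m _; have [_ [_ []]] := xIP m.
rewrite sumr_const card_ord -[ltRHS]mulr_natl natrM.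
have : 0 < (n%:R : R) by rewrite ltr0n.
nra.
Qed.

(** * Elementary functionals on alternating sums *)

Section Upper.
Variables (theta : R) (n K0 : nat) (l : nat -> seq (seq (c00 R))).
Hypothesis delta_le : delta <= theta.
Hypothesis sl : forall k, (K0 <= k)%N -> (size (l k) < n)%N.
Hypothesis lP : forall k t, (K0 <= k)%N -> histories k theta t -> t \in l k.

(** Values above 1 in modulus are replaced by 0 to provide the bound [ultra_select] asks for. The
    sum of a genuine past is a special functional, of value at most 1 on [u k], and is left
    unchanged. *)
Definition history_act k' i k : R :=
  let v := act (\sum_(f <- nth [::] (l k') i) f) (u k) in
  if `|v| <= 1 then v else 0.

Lemma history_act_le1 k' i k : `|history_act k' i k| <= 1.
Proof. by rewrite /history_act /=; case: ifP => // _; rewrite normr0. Qed.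

Variables (kappa : nat -> nat) (r : nat -> R).
Hypothesis kappa_ge : forall m, (K0 <= kappa m)%N.
Hypothesis kappa_lt : forall m m', (m < m')%N -> (kappa m < kappa m')%N.
Hypothesis r1 : forall i, `|r i| <= 1.
Hypothesis rP : forall m m' i, (m < m')%N -> (i < n)%N ->
  `|history_act (kappa m') i (kappa m) - r i| <= theta.

Lemma elementary_spf s N a e : special F Xi1 sigma s (Some N) ->
  elementary F Xi1 sigma (spf s N a e).
Proof. by move=> sp; left; eexists; exact: (special_functional_spf a e sp). Qed.

Lemma last_active d (B : nat -> R) : 0 < theta ->
  (exists2 m0, (m0 < d)%N & theta <= `|B m0| /\ forall m, (m0 < m < d)%N -> `|B m| < theta)
  \/ forall m, (m < d)%N -> `|B m| < theta.
Proof.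
move=> th0; have [ex|nex] := pselect (exists m, (m < d)%N && (theta <= `|B m|)); last first.
  right=> m md; rewrite ltNge; apply/negP => h; apply: nex; exists m; exact/andP.
have ub m : (m < d)%N && (theta <= `|B m|) -> (m <= d)%N by move=> /andP[/ltnW].
have [m0 /andP[md hm] mmax] := ex_maxnP ex ub; left; exists m0 => //; split=> // m /andP[mm0 md'].
rewrite ltNge; apply/negP => h; have := mmax m; rewrite md' h => /(_ isT).
by rewrite leqNgt mm0.
Qed.

Lemma special_upper s N e d : 0 < theta -> (0 < d)%N -> special F Xi1 sigma s (Some N) ->
  `|act (spf s N 0 e) (\sum_(m < d) (-1) ^+ m *: u (kappa m))| <= 2 + d%:R * (2 * theta).
Proof.
move=> th0 d0 sp; rewrite act_sumr; under eq_bigr do rewrite actZr.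
pose B m := act (spf s N 0 e) (u (kappa m)).
have B1 m : `|B m| <= 1.
  by rewrite /B -[leRHS](u1 (kappa m)); apply: (elementary_le hG hX); exact: elementary_spf.
have [[m0 m0d [big small]]|small] := last_active d B th0; last first.
  apply: (@alternating_sum_le _ B d 0 0) => //; rewrite ?normr0 ?mulr_ge0 // ?ltW //.
  by move=> m /andP[_ /small/ltW h]; apply: (le_trans h); rewrite ler_peMl ?ler1n // ltW.
have th2 : theta <= 2 * theta by rewrite ler_peMl ?ler1n // ltW.
have ltail m : (m0 < m < d)%N -> `|B m| <= 2 * theta.
  by move=> /small/ltW h; exact: le_trans th2.
have [p pN pJ] := threshold (J (kappa m0)) sp.
(* The functional does not vanish on the block of index [kappa m0], so [e] lies beyond all earlier
   blocks and the restriction is not felt there. *)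
have eP m k : (m < m0)%N -> u (kappa m) k != 0 -> (0 <= k <= e)%N.
  move=> mm0 uk /=; have [k' [sk' uk']] := @act_neq0 _ (spf s N 0 e) (u (kappa m0))
    ltac:(rewrite -normr_gt0; exact: lt_le_trans big).
  have /andP[_ ke] := spf_supp sk'; have /andP[_ h1] := blocks_in bu uk.
  have /andP[h2 _] := blocks_in bu uk'.
  have := blocks_mono bu (kappa_lt mm0); lia.
(* Members from position [p] on have indices at least [J (kappa m0)], beyond the window of every
   earlier term; together they contribute at most delta. *)
have Bsplit m : (m < m0)%N -> `|B m - \sum_(i < p) act (s i) (u (kappa m))| <= theta.
  move=> mm0; have -> : \sum_(i < p) act (s i) (u (kappa m)) =
      \sum_(i < N) if (i < p)%N then act (restr `[0%N, e] (s i)) (u (kappa m)) else 0.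
    rewrite -big_mkcond /= (big_ord_widen N (fun i => act (s i) (u (kappa m)))) //.
    apply: eq_bigr => i _; rewrite act_restr // => k; exact: eP.
  rewrite /B act_spf -sumrB; apply: le_trans (ler_norm_sum _ _ _) _.
  apply: le_trans delta_le.
  have -> : \sum_(i < N) `|act (restr `[0%N, e] (s i)) (u (kappa m)) -
      (if (i < p)%N then act (restr `[0%N, e] (s i)) (u (kappa m)) else 0)| =
    \sum_(i < N - p) `|act (restr `[0%N, e] (s (p + i)%N)) (u (kappa m))|.
    rewrite -(big_mkord xpredT (fun i => `|act (restr `[0%N, e] (s i)) (u (kappa m)) -
      (if (i < p)%N then act (restr `[0%N, e] (s i)) (u (kappa m)) else 0)|)).
    rewrite (big_cat_nat _ (n := p)) //= big_nat big1 ?add0r; last first.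
      by move=> i /= ip; rewrite ip subrr normr0.
    rewrite -{1}[p]add0n big_addn big_mkord; apply: eq_bigr => i _.
    by rewrite ltnNge leq_addl /= subr0 addnC.
  apply: (@win (kappa m) _ (fun i => restr `[0%N, e] (s (p + i)%N)) (fun i => idx F sigma s (p + i))).
  - by move=> i iN; apply: F_restr0 => //; left; apply: (F_idx sp); lia.
  - by move=> i j ij; apply: (idx_lt hsigma sp); lia.
  - move=> i iN; have := pJ (p + i)%N; have -> : (p + i < p)%N = false by lia.
    have := J_mono (kappa_lt mm0); lia.
case: (posnP p) => [p0|p0].
  apply: (@alternating_sum_le _ B d m0 0) => //; rewrite ?normr0 ?mulr_ge0 // ?ltW //.
  by move=> m mm0; have := Bsplit m mm0; rewrite p0 big_ord0 => h; exact: le_trans th2.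
have /(lP (kappa_ge m0)) tl : histories (kappa m0) theta (mkseq s p).
  by exists s, N, e, p; rewrite p0.
pose i := index (mkseq s p) (l (kappa m0)).
have il : (i < n)%N by apply: leq_trans (sl (kappa_ge m0)); rewrite ltnS ltnW // index_mem.
apply: (@alternating_sum_le _ B d m0 (r i)) => //; first by rewrite mulr_ge0 // ltW.
move=> m mm0; have := rP mm0 il; rewrite /history_act /i nth_index //=.
have -> : \sum_(f <- mkseq s p) f = \sum_(i < p) s i.
  have pE : index_iota 0 p = seq.iota 0 p by rewrite /index_iota subn0.
  by rewrite big_map -pE big_mkord.
rewrite act_suml.
(* The past is itself a special functional, so the cutoff in [history_act] is inactive. *)
have -> : `|\sum_(i < p) act (s i) (u (kappa m))| <= 1.
  have spp : special F Xi1 sigma s (Some p).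
    by apply: (special_sub sp) => // q /= qp; exact: leq_trans pN.
  have := elementary_le hG hX (u (kappa m)) (elementary_spf 0 e spp).
  rewrite u1 act_spf; congr (`|_| <= _); apply: eq_bigr => q _.
  by rewrite act_restr // => k; exact: eP.
move=> h; have := Bsplit m mm0; move: h.
rewrite -/i; set S := \sum_(_ < p) _ => h1 h2.
rewrite (_ : B m - r i = (B m - S) + (S - r i)); last by ring.
by apply: le_trans (ler_normD _ _) _; lra.
Qed.

Lemma elementary_upper x d : 0 < theta -> (0 < d)%N -> elementary F Xi1 sigma x ->
  `|act x (\sum_(m < d) (-1) ^+ m *: u (kappa m))| <= 2 * (2 + d%:R * (2 * theta)).
Proof.
move=> th0 d0; set v := \sum_(m < d) _.
set C := 2 + _; have C0 : 0 <= C by rewrite addr_ge0 // mulr_ge0 // mulr_ge0 // ltW.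
case=> [[I xI]|[j /= j1 Fx]].
  have [s [N [a [e [sp ->]]]]] := special_functionalP xI.
  have [ae|ea] := leqP a e; last first.
    rewrite act_disj ?normr0 ?mulr_ge0 // => k _; apply/eqP; apply: contraT => /spf_supp; lia.
  case: a ae => [|a] ae.
    by apply: le_trans (special_upper e th0 d0 sp) _; rewrite ler_peMl // ler1n.
  (* Pasts were taken for intervals starting at 0. Any other interval is a difference of two such,
     whence the factor 2. *)
  have -> : spf s N a.+1 e = spf s N 0 e - spf s N 0 a.
    rewrite /spf -sumrB; apply: eq_bigr => i _; apply: c00P => k.
    rewrite [RHS](_ : _ = restr `[0%N, e] (s i) k - restr `[0%N, a] (s i) k) // !restrE /=.
    have [ka|ak] := leqP k a; first by rewrite (leq_trans ka (ltnW ae)) subrr.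
    by rewrite subr0.
  rewrite actBl; apply: le_trans (ler_normB _ _) _.
  by have := special_upper e th0 d0 sp; have := special_upper a th0 d0 sp; rewrite -/v -/C; lra.
apply: (@le_trans _ _ C); last by rewrite ler_peMl // ler1n.
rewrite /v act_sumr; under eq_bigr do rewrite actZr.
pose B m := act x (u (kappa m)).
have B1 m : `|B m| <= 1.
  by rewrite /B -[leRHS](u1 (kappa m)); apply: (elementary_le hG hX); right; exists j.
have th2 : theta <= 2 * theta by rewrite ler_peMl ?ler1n // ltW.
have small m : ~~ (J (kappa m) <= j < J (kappa m).+1)%N -> `|B m| <= 2 * theta.
  move=> nj; apply: le_trans th2; apply: le_trans delta_le.
  exact: (window1 (@win (kappa m)) (or_introl Fx) nj).
(* The windows are disjoint, so a member of F_j can exceed delta on one term only. *)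
have [[m0 [m0d jm]]|nex] := pselect (exists m, (m < d)%N /\ (J (kappa m) <= j < J (kappa m).+1)%N); last first.
  apply: (@alternating_sum_le _ B d 0 0) => //; rewrite ?normr0 ?mulr_ge0 // ?ltW //.
  move=> m /andP[_ md]; apply: small; apply/negP => h; apply: nex; by exists m.
apply: (@alternating_sum_le _ B d m0 0) => //; rewrite ?normr0 ?mulr_ge0 // ?ltW //.
  move=> m mm0; rewrite subr0; apply: small; have := J_mono (kappa_lt mm0); lia.
move=> m /andP[mm0 md]; apply: small; have := J_mono (kappa_lt mm0); lia.
Qed.

End Upper.

End Sequence.

Lemma elementary_small V N (eps : R) : rich V -> 0 < eps ->
  exists y, [/\ V y, supp_ge N y, `|iota y| = 1 &
    forall x, elementary F Xi1 sigma x -> `|act x y| <= eps].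
Proof.
move=> [V0 VL Vr] eps0.
pose W := [set y | V y /\ supp_ge N y].
have rW : rich W.
  split; first by split=> //; exact: supp_ge0.
    move=> c y z [Vy yN] [Vz zN]; split; first exact: VL.
    by apply: supp_geD => //; exact: supp_geZ.
  move=> M; have [v [Vv v0 vM]] := Vr (maxn N M); exists v; split=> //.
    by split=> //; exact: supp_geW (leq_maxl _ _) vM.
  exact: supp_geW (leq_maxr _ _) vM.
apply: contrapT => nex.
(* By homogeneity, the failure of the claim concerns all nonzero vectors of [W], the alternating sum
   included. *)
have act_gt y : W y -> 0 < `|iota y| ->
    exists2 x, elementary F Xi1 sigma x & eps * `|iota y| < `|act x y|.
  move=> Wy y0; apply: contrapT => h; apply: nex.
  have [Vy' yN'] := richZ `|iota y|^-1 rW Wy.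
  exists (`|iota y|^-1 *: y); split=> //.
    by rewrite linearZ normrZ normfV normr_id mulVf // gt_eqF.
  move=> x ex; rewrite actZr normrM normfV normr_id ler_pdivrMl // mulrC leNgt.
  by apply/negP => hx; apply: h; exists x.
(* The constant 12 makes eps * (n * (eps / 2)) exceed 6, the upper estimate for elementary
   functionals. *)
have [n n_gt] : exists n : nat, 12 / eps ^+ 2 < n%:R.
  by exists (Num.truncn (12 / eps ^+ 2)).+1; exact: truncnS_gt.
have n0R : 0 < n%:R :> R by apply: lt_trans n_gt; rewrite divr_gt0 // exprn_gt0.
have n0 : (0 < n)%N by rewrite -(ltr0n R).
pose d := (n * n)%N; have d0 : (0 < d)%N by rewrite muln_gt0 n0.
have d0R : 0 < d%:R :> R by rewrite ltr0n.
(* With this value d * (2 * theta) = 1, so the upper estimate is 2 * (2 + 1) = 6. *)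
pose theta : R := (2 * d%:R)^-1.
have th0 : 0 < theta by rewrite invr_gt0 mulr_gt0.
(* theta / 3 serves the count of pasts, eps / 2 the lower estimate. *)
pose delta := Num.min (theta / 3) (eps / 2).
have de0 : 0 < delta by rewrite lt_min !divr_gt0.
have dth : delta <= theta / 3 by rewrite ge_min lexx.
have deps : delta <= eps / 2 by rewrite ge_min lexx orbT.
have [b [u [J [bu Wu u1 J_lt win]]]] := ris_exist hF hG hX rW de0.
have [n' n'_gt] : exists n' : nat, 2 / theta < n'%:R.
  by exists (Num.truncn (2 / theta)).+1; exact: truncnS_gt.
have n'th : 2 < n'%:R * theta by rewrite -ltr_pdivrMr.
pose K0 := maxn (n' * n') d.
have /choice[l lP] : forall k, exists l : seq (seq (c00 R)), (K0 <= k)%N ->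
    (size l < n' * n')%N /\ forall t, histories u J k theta t -> t \in l.
  move=> k; have [Kk|_] := leqP K0 k; last by exists [::].
  have [|lk h1 h2] := histories_finite bu u1 win th0 dth n'th (k := k).
    by apply: leq_trans Kk; exact: leq_maxl.
  by exists lk.
have sl k : (K0 <= k)%N -> (size (l k) < n' * n')%N by move=> /lP[].
have lH k t : (K0 <= k)%N -> histories u J k theta t -> t \in l k.
  by move=> Kk; have [_ h] := lP k Kk; exact: h.
have [kappa [r [kge klt r1 rP]]] := @ultra_select R (n' * n') K0
  (history_act u l) theta (history_act_le1 u l) th0.
pose v := \sum_(m < d) (-1) ^+ m *: u (kappa m).
have dn m : (n * n <= kappa m)%N by apply: leq_trans (kge m); exact: leq_maxr.
have hu k : exists2 x, elementary F Xi1 sigma x & eps < `|act x (u k)|.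
  by have := act_gt (u k) (Wu k); rewrite u1 mulr1; apply.
have low : n%:R * (eps / 2) <= `|iota v|.
  apply: (ris_lower bu J_lt win hu deps eps0 n0 dn klt (c := fun m => (-1) ^+ m)) => m.
  by rewrite normrX normrN1 expr1n.
have v0 : 0 < `|iota v| by apply: lt_le_trans low; rewrite mulr_gt0 // divr_gt0.
have Wv : W v.
  have [W0 WL _] := rW.
  exact: (subspace_sum (n := d) (fun m => (-1) ^+ m) W0 WL (fun m _ => Wu (kappa m))).
have [x ex xv] := act_gt v Wv v0.
have dth' : delta <= theta by apply: (le_trans dth); lra.
have := elementary_upper bu u1 J_lt win dth' sl lH kge klt r1 rP th0 d0 ex.
rewrite -/v leNgt => /negP; apply; apply: le_lt_trans xv.
have -> : 2 * (2 + d%:R * (2 * theta)) = 6.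
  by rewrite /theta; field; rewrite gt_eqF.
apply: (@le_trans _ _ (eps * (n%:R * (eps / 2)))); last by rewrite ler_wpM2l // ltW.
rewrite (_ : eps * _ = n%:R * eps ^+ 2 / 2); last by field.
by move: n_gt; rewrite ltr_pdivrMr ?exprn_gt0 // => h; lra.
Qed.

End Core.

(** * Sequences equivalent to the unit basis of c_0 *)

(** Helly's theorem on the line: pairwise intersecting intervals with centers p i and radii q i have
    a common point, here the supremum of their left ends. *)
Lemma common_center (R : realType) (I : Type) (i0 : I) (p q : I -> R) :
  (forall i j, p i - p j <= q i + q j) -> exists c, forall i, `|p i - c| <= q i.
Proof.
move=> h; pose A := [set p i - q i | i in [set: I]].
have A0 : A !=set0 by exists (p i0 - q i0), i0.
have ubA j : ubound A (p j + q j) by move=> _ [i _ <-]; have := h i j; lra.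
exists (sup A) => i.
have h1 : p i - q i <= sup A.
  by apply: ub_le_sup; [exists (p i + q i); exact: ubA | exists i].
have h2 : sup A <= p i + q i by apply: ge_sup => //; exact: ubA.
rewrite ler_norml; apply/andP; split; lra.
Qed.

Lemma closure_normP (R : realType) (X : normedModType R) (A : set X) x :
  closure A x <-> forall e : R, 0 < e -> exists2 y, A y & `|y - x| < e.
Proof.
split=> [h e e0|h B].
  have [y [Ay xy]] := h _ (nbhsx_ballx x e e0).
  by exists y => //; move: xy; rewrite -ball_normE /= distrC.
rewrite -nbhs_ballE => -[e /= e0 sub]; have [y Ay xy] := h e e0.
by exists y; split=> //; apply: sub; rewrite -ball_normE /= distrC.
Qed.

Lemma ler_forall_eps (R : realType) (x C : R) : 0 <= C ->
  (forall e : R, 0 < e -> x <= C * e) -> x <= 0.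
Proof.
move=> C0 h; apply/ler_addgt0Pl => e e0; rewrite addr0.
have C1 : 0 < C + 1 by rewrite ltr_wpDl.
apply: le_trans (h (e / (C + 1)) (divr_gt0 e0 C1)) _.
by rewrite mulrCA ler_piMr ?(ltW e0) // ler_pdivrMr // mul1r lerDl.
Qed.

Section Coordinates.
Variables (R : realType) (X : completeNormedModType R) (L : c00 R -> X).
Variables (lo : R).
Hypothesis lo0 : 0 < lo.
Hypothesis L_lin : forall (c : R) a b, L (c *: a + b) = c *: L a + L b.
Hypothesis L_lower : forall (a : c00 R) k, lo * `|a k : R| <= `|L a|.

Lemma Lcomb0 : L 0 = 0.
Proof. by have := L_lin (-1) 0 0; rewrite !scaleN1r !addNr. Qed.

Lemma LcombB a b : L (a - b) = L a - L b.
Proof. by have := L_lin (-1) b a; rewrite !scaleN1r ![- _ + _]addrC. Qed.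

(** By the lower estimate for L (a - b), the intervals of radius [|L a - x| / lo] around [a k] meet
    pairwise. On the closed span, their common point is the continuous extension of the k-th
    coordinate. *)
Lemma coordinate_ex x : exists c : nat -> R,
  forall (a : c00 R) k, lo * `|(a k : R) - c k| <= `|L a - x|.
Proof.
have /choice[c cP] : forall k, exists c : R,
    forall a : c00 R, `|(a k : R) - c| <= `|L a - x| / lo.
  move=> k; apply: (common_center 0) => a b.
  rewrite -mulrDl ler_pdivlMr // mulrC.
  apply: (@le_trans _ _ `|L (a - b)|).
    apply: le_trans (L_lower (a - b) k); rewrite ler_pM2l //; exact: ler_norm.
  rewrite LcombB (_ : L a - L b = (L a - x) - (L b - x)); first exact: ler_normB.
  by rewrite opprB addrA subrK.
exists c => a k; have := cP k a; rewrite ler_pdivlMr // mulrC; exact.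
Qed.

Definition coordinate x : nat -> R := projT1 (cid (coordinate_ex x)).

Lemma coordinateP x (a : c00 R) k : lo * `|(a k : R) - coordinate x k| <= `|L a - x|.
Proof. by rewrite /coordinate; case: cid => /= c h; exact: h. Qed.

Lemma coordinate_le x k : lo * `|coordinate x k| <= `|x|.
Proof.
by have := coordinateP x 0 k; rewrite Lcomb0 !sub0r !normrN.
Qed.

Definition Lspan := closure (range L).

Lemma LspanP x : Lspan x <-> forall e : R, 0 < e -> exists a, `|L a - x| < e.
Proof.
rewrite /Lspan closure_normP; split=> h e e0.
  by have [_ [a _ <-] ha] := h e e0; exists a.
by have [a ha] := h e e0; exists (L a) => //; exists a.
Qed.

Lemma Lspan_L a : Lspan (L a).
Proof. by apply/LspanP => e e0; exists a; rewrite subrr normr0. Qed.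

Lemma Lcomb_approx (c : R) a b x y :
  `|L (c *: a + b) - (c *: x + y)| <= `|c| * `|L a - x| + `|L b - y|.
Proof.
rewrite L_lin opprD addrACA -scalerBr -normrZ; exact: ler_normD.
Qed.

Lemma Lspan_lin (c : R) x y : Lspan x -> Lspan y -> Lspan (c *: x + y).
Proof.
move=> /LspanP hx /LspanP hy; apply/LspanP => e e0.
have c1 : 0 < `|c| + 1 by rewrite ltr_wpDl.
have [a ha] := hx (e / 2 / (`|c| + 1)) ltac:(by rewrite !divr_gt0).
have [b hb] := hy (e / 2) ltac:(by rewrite divr_gt0).
exists (c *: a + b); apply: le_lt_trans (Lcomb_approx c a b x y) _.
rewrite [ltRHS]splitr ler_ltD //; move: ha; rewrite ltr_pdivlMr // => ha.
by apply: le_trans (ltW ha); rewrite mulrC ler_wpM2l // lerDl.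
Qed.

Lemma Lspan0 : Lspan 0.
Proof. by rewrite -Lcomb0; exact: Lspan_L. Qed.

Lemma coordinate_uniq x (c : nat -> R) k : Lspan x ->
  (exists2 C, 0 <= C & forall e, 0 < e ->
     exists a, `|L a - x| <= C * e /\ `|(a k : R) - c k| <= C * e) ->
  coordinate x k = c k.
Proof.
move=> Zx [C C0 h]; apply/eqP; rewrite -subr_eq0 -normr_le0.
suff : lo * `|coordinate x k - c k| <= 0 by rewrite pmulr_rle0.
apply: (@ler_forall_eps _ _ (C + lo * C)) => [|e e0].
  by rewrite addr_ge0 // mulr_ge0 // ltW.
have [a [h1 h2]] := h e e0; have h3 := coordinateP x a k.
rewrite (_ : coordinate x k - c k = - ((a k : R) - coordinate x k) + ((a k : R) - c k)); last by ring.
apply: (@le_trans _ _ (lo * (`|(a k : R) - coordinate x k| + `|(a k : R) - c k|))).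
  by rewrite ler_pM2l // (le_trans (ler_normD _ _)) // normrN.
rewrite mulrDr mulrDl lerD //; first exact: le_trans h3 h1.
by rewrite -mulrA ler_pM2l.
Qed.

Lemma coordinate_lin (c : R) x y k : Lspan x -> Lspan y ->
  coordinate (c *: x + y) k = c * coordinate x k + coordinate y k.
Proof.
move=> Zx Zy.
apply: (coordinate_uniq (c := fun k => c * coordinate x k + coordinate y k)); first exact: Lspan_lin.
pose C := `|c| + 1; have C0 : 0 <= C by rewrite addr_ge0.
exists (C + C / lo) => [|e e0]; first by rewrite addr_ge0 // divr_ge0 // ltW.
have [a ha] := (LspanP x).1 Zx e e0; have [b hb] := (LspanP y).1 Zy e e0.
exists (c *: a + b); split.
  apply: le_trans (Lcomb_approx c a b x y) _.
  apply: (@le_trans _ _ (C * e)); last by rewrite ler_wpM2r ?(ltW e0) // lerDl divr_ge0 // ltW.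
  by rewrite mulrDl mul1r lerD ?(ltW hb) // ler_wpM2l // ltW.
have ha' : `|(a k : R) - coordinate x k| <= e / lo.
  by rewrite ler_pdivlMr // mulrC; apply: le_trans (coordinateP x a k) (ltW ha).
have hb' : `|(b k : R) - coordinate y k| <= e / lo.
  by rewrite ler_pdivlMr // mulrC; apply: le_trans (coordinateP y b k) (ltW hb).
rewrite (_ : _ - _ = c * ((a k : R) - coordinate x k) + ((b k : R) - coordinate y k)); last first.
  by rewrite [X in X - _](_ : _ = c * (a k : R) + (b k : R)) //; ring.
apply: (@le_trans _ _ (C * (e / lo))).
  apply: le_trans (ler_normD _ _) _; rewrite normrM mulrDl mul1r lerD // ler_wpM2l //.
have -> : (C + C / lo) * e = C * e + C * (e / lo) by ring.
by rewrite lerDr mulr_ge0 // ltW.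
Qed.

Lemma coordinate_cvg0 x : Lspan x -> coordinate x @ \oo --> (0 : R).
Proof.
move=> Zx; apply/cvgrPdist_le => e e0.
have [a ha] := (LspanP x).1 Zx (lo * e) ltac:(by rewrite mulr_gt0).
have [N aN] := c00_supp_lt a; exists N => // k /= Nk.
have := coordinateP x a k; rewrite (supp_ltNge aN Nk) => h.
by rewrite -(ler_pM2l lo0); apply: (le_trans h); exact: ltW.
Qed.

Section Upper.
Variable hi : R.
Hypothesis hi0 : 0 <= hi.
Hypothesis L_upper : forall (a : c00 R) (M : R), 0 <= M -> (forall k, `|a k : R| <= M) -> `|L a| <= hi * M.

Lemma coordinate_upper x M : Lspan x -> 0 <= M ->
  (forall k, `|coordinate x k| <= M) -> `|x| <= hi * M.
Proof.
move=> Zx M0 h; rewrite -subr_le0.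
apply: (@ler_forall_eps _ _ (1 + hi / lo)) => [|e e0].
  by rewrite addr_ge0 // divr_ge0 // ltW.
have [a ha] := (LspanP x).1 Zx e e0.
have a_le k : `|a k : R| <= M + e / lo.
  rewrite (_ : (a k : R) = coordinate x k + ((a k : R) - coordinate x k)); last by ring.
  apply: le_trans (ler_normD _ _) _; rewrite lerD //.
  by rewrite ler_pdivlMr // mulrC; apply: le_trans (coordinateP x a k) (ltW ha).
have Me0 : 0 <= M + e / lo by rewrite addr_ge0 // divr_ge0 // ltW.
have La := L_upper Me0 a_le.
rewrite lerBlDr; have -> : x = L a - (L a - x) by rewrite opprB addrC subrK.
apply: le_trans (ler_normB _ _) _; apply: le_trans (lerD La (ltW ha)) _.
by rewrite le_eqVlt; apply/orP; left; apply/eqP; rewrite mulrDr mulrDl mul1r; ring.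
Qed.

(** By the upper estimate, the images of the truncations of [u] form a Cauchy sequence, because the
    tails of [u] are uniformly small. *)
Lemma coordinate_surj (u : nat -> R) : u @ \oo --> (0 : R) ->
  exists2 x, Lspan x & forall k, coordinate x k = u k.
Proof.
move=> u0.
pose t n : c00 R := \sum_(k < n) u k *: unitvec k.
have tE n k : t n k = (if (k < n)%N then u k else 0) :> R.
  rewrite /t c00_sum; case: ifPn => kn.
    rewrite (bigD1 (Ordinal kn)) //= [X in X + _](_ : _ = u k * (k == k)%:R) // eqxx mulr1.
    rewrite big1 ?addr0 // => i; rewrite -val_eqE /= => ik.
    by rewrite [LHS](_ : _ = u i * (k == i)%:R) // eq_sym (negbTE ik) mulr0.
  rewrite big1 // => i _; rewrite [LHS](_ : _ = u i * (k == i)%:R) //.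
  by rewrite gtn_eqF ?mulr0 // (leq_trans (ltn_ord i)) // leqNgt.
have small (e : R) : 0 < e -> exists N, forall n m, (N <= n)%N -> (N <= m)%N -> `|L (t n) - L (t m)| <= hi * e.
  move=> e0; have /cvgrPdist_le/(_ e e0)[N _ hN] := u0; exists N => n m Nn Nm.
  rewrite -LcombB; apply: L_upper; first exact: ltW.
  move=> k; rewrite [X in `|X|](_ : _ = (t n k : R) - (t m k : R)) // !tE.
  have [Nk|kN] := leqP N k; last first.
    by rewrite !(leq_trans kN) // subrr normr0 ltW.
  have := hN k Nk; rewrite /= sub0r normrN => uk.
  by do 2 case: ifP => _; rewrite ?subrr ?subr0 ?sub0r ?normrN ?normr0 // ltW.
have hi1 : 0 < hi + 1 by rewrite ltr_wpDl.
have cv : cvgn (L \o t).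
  apply/cauchy_cvgP/cauchy_exP => e e0.
  have [N hN] := small (e / (hi + 1)) ltac:(by rewrite divr_gt0).
  exists (L (t N)); exists N => // n /= Nn; rewrite -ball_normE /=.
  apply: le_lt_trans (hN N n (leqnn N) Nn) _.
  by rewrite mulrCA gtr_pMr // ltr_pdivrMr // mul1r ltrDl.
pose x := limn (L \o t).
have xP (e : R) : 0 < e -> exists N, forall n, (N <= n)%N -> `|L (t n) - x| <= e.
  move=> e0; have /cvgrPdist_le/(_ e e0)[N _ hN] := cv; exists N => n Nn.
  by rewrite distrC; exact: hN.
have Zx : Lspan x.
  apply/LspanP => e e0; have [N hN] := xP (e / 2) ltac:(by rewrite divr_gt0).
  by exists (t N); apply: le_lt_trans (hN N (leqnn N)) _; rewrite ltr_pdivrMr // ltr_pMr // ltr1n.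
exists x => // k; apply: coordinate_uniq => //; exists 1 => // e e0.
have [N hN] := xP e e0; exists (t (maxn N k.+1)); rewrite mul1r; split.
  by apply: hN; exact: leq_maxl.
by rewrite tE leq_max ltnSn orbT subrr normr0 ltW.
Qed.

Lemma isomorphic_c0 C : hi / lo <= C -> isomorphic_within C Lspan [set: c0 R].
Proof.
move=> hiC.
have c0P x : Lspan x -> (coordinate x : nat -> R^o) \in @c0_pred R.
  by move=> Zx; apply: mem_set; exact: coordinate_cvg0.
(* Convergence of the coordinates to 0 is available on the closed span, hence the default 0
   elsewhere. *)
pose T x : c0 R := match pselect (Lspan x) with
  left Zx => C0 (c0P x Zx) | right _ => 0 end.
have TE x k : Lspan x -> T x k = coordinate x k :> R.
  by rewrite /T; case: pselect.
have c0_ext (u v : c0 R) : (forall k, u k = v k :> R) -> u = v.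
  by move=> uv; apply/val_inj/funext => k; exact: uv.
have /choice[S SP] : forall u : c0 R, exists x, Lspan x /\ forall k, coordinate x k = u k.
  move=> u; have /set_mem/= cu := valP u.
  by have [x Zx xu] := coordinate_surj cu; exists x.
have T_le x : Lspan x -> `|T x| <= `|x| / lo.
  move=> Zx; apply: c0_norm_le => k; rewrite ler_pdivlMr // mulrC.
  by rewrite [X in `|X|](_ : _ = coordinate x k) ?coordinate_le // TE.
have S_le u : `|S u| <= hi * `|u|.
  apply: coordinate_upper => //; first by case: (SP u).
  by move=> k; case: (SP u) => _ ->; exact: c0_norm_ub.
have opT : (opnorm Lspan T <= (1 / lo)%:E)%E.
  apply: ge_ereal_sup => _ [x [Zx /= x1] <-]; rewrite lee_fin.
  by apply: le_trans (T_le x Zx) _; rewrite ler_pM2r ?invr_gt0.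
have opS : (opnorm [set: c0 R] S <= hi%:E)%E.
  apply: ge_ereal_sup => _ [u [_ /= u1] <-]; rewrite lee_fin.
  by apply: le_trans (S_le u) _; rewrite ler_piMr.
exists T, S; split.
- move=> c x y Zx Zy; apply: c0_ext => k.
  rewrite [RHS](_ : _ = c * (T x k : R) + (T y k : R)) // !TE //; last exact: Lspan_lin.
  exact: coordinate_lin.
- by split=> // u _; case: (SP u).
- split=> [x Zx|u _].
    have [ZS SE] := SP (T x); apply/eqP; rewrite -subr_eq0 -normr_le0 -(mulr0 hi).
    have -> : S (T x) - x = (-1) *: x + S (T x) by rewrite scaleN1r addrC.
    apply: coordinate_upper => //; first exact: Lspan_lin.
    by move=> k; rewrite coordinate_lin // SE TE // mulN1r addrC subrr normr0.
  by have [ZS SE] := SP u; apply: c0_ext => k; rewrite TE.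
- by split; [apply: le_lt_trans opT _|apply: le_lt_trans opS _]; exact: ltry.
- have T0 : (0 <= opnorm Lspan T)%E.
    apply: (@le_trans _ _ (`|T 0|)%:E); first by rewrite lee_fin.
    by apply: ereal_sup_ubound; exists 0 => //; split; [exact: Lspan0 | rewrite /= normr0].
  have S0 : (0 <= opnorm [set: c0 R] S)%E.
    apply: (@le_trans _ _ (`|S 0|)%:E); first by rewrite lee_fin.
    by apply: ereal_sup_ubound; exists 0 => //; split=> //=; rewrite normr0.
  apply: le_trans (lee_pmul T0 S0 opT opS) _.
  by rewrite -EFinM lee_fin mul1r mulrC.
Qed.

End Upper.
End Coordinates.

(** * Proof of the theorem *)

Lemma actC (R : realType) (f x : c00 R) : act f x = act x f.
Proof. by apply: eq_fsbigr => n _; exact: mulrC. Qed.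

Section Combination.
Variables (R : realType) (W : lmodType R) (z : nat -> W).

Definition combination (a : c00 R) : W :=
  \sum_(i < projT1 (cid (c00_supp_lt a))) (a i : R) *: z i.

Lemma combinationE N (a : c00 R) : supp_lt N a ->
  combination a = \sum_(i < N) (a i : R) *: z i.
Proof.
move=> aN; rewrite /combination; case: cid => M /= aM.
have E K : (K <= maxn N M)%N -> supp_lt K a ->
    \sum_(i < K) (a i : R) *: z i = \sum_(i < maxn N M) (a i : R) *: z i.
  move=> KM aK; rewrite (big_ord_widen (maxn N M) (fun i => (a i : R) *: z i)) //.
  rewrite big_mkcond /=; apply: eq_bigr => i _; case: ltnP => // Ki.
  by rewrite (supp_ltNge aK Ki) scale0r.
by rewrite (E M (leq_maxr _ _) aM) (E N (leq_maxl _ _) aN).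
Qed.

Lemma combination_lin (c : R) (a b : c00 R) :
  combination (c *: a + b) = c *: combination a + combination b.
Proof.
have [N aN] := c00_supp_lt a; have [M bM] := c00_supp_lt b.
have aK := supp_ltW (leq_maxl N M) aN; have bK := supp_ltW (leq_maxr N M) bM.
rewrite (combinationE aK) (combinationE bK).
rewrite (combinationE (supp_ltD (@supp_ltZ _ _ c _ aK) bK)).
rewrite scaler_sumr -big_split /=; apply: eq_bigr => i _.
by rewrite scalerA -scalerDl.
Qed.

End Combination.

Lemma finite_codimension (R : realType) (X : lmodType R) (Y : set X) (phi : nat -> X -> R) N :
  (forall (a : R) x y, Y x -> Y y -> Y (a *: x + y)) -> Y 0 ->
  (forall k (c : R) x y, phi k (c *: x + y) = c * phi k x + phi k y) ->
  exists m (v : nat -> X), (forall i, Y (v i)) /\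
    forall y, Y y -> exists c : nat -> R, forall k, (k < N)%N -> phi k (y - \sum_(i < m) c i *: v i) = 0.
Proof.
move=> YL Y0 phiL; elim: N => [|N [m [v [Yv hv]]]].
  by exists 0%N, (fun=> 0); split=> // y _; exists (fun=> 0).
have YB y m' (c : nat -> R) (w : nat -> X) : (forall i, Y (w i)) -> Y y -> Y (y - \sum_(i < m') c i *: w i).
  by move=> Yw Yy; rewrite addrC -scaleN1r; apply: (YL) => //; exact: (subspace_sum (n := m') c Y0 YL (fun i _ => Yw i)).
(* Either a vector of [Y] killed by the first [N] functionals is not killed by [phi N], and it joins
   the list, or the old list already serves [phi N]. *)
have [[w [Yw w0 wN]]|nex] := pselect (exists w, [/\ Y w, forall k, (k < N)%N -> phi k w = 0 & phi N w != 0]); last first.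
  exists m, v; split=> // y Yy; have [c hc] := hv y Yy; exists c => k.
  rewrite ltnS leq_eqVlt => /orP[/eqP->|]; last exact: hc.
  apply/eqP; apply: contra_notT nex => h; exists (y - \sum_(i < m) c i *: v i).
  by split=> //; exact: YB.
exists m.+1, (fun i => if (i < m)%N then v i else w); split.
  by move=> i; case: ifP.
move=> y Yy; have [c hc] := hv y Yy; set y' := y - _ in hc.
pose q := phi N y' / phi N w.
exists (fun i => if (i < m)%N then c i else q) => k kN.
have -> : y - \sum_(i < m.+1) (if (i < m)%N then c i else q) *: (if (i < m)%N then v i else w) = (- q) *: w + y'.
  rewrite big_ord_recr /= ltnn.
  under eq_bigr => i _ do rewrite ltn_ord.
  by rewrite /y' scaleNr opprD addrA [RHS]addrC.
rewrite phiL; move: kN; rewrite ltnS leq_eqVlt => /orP[/eqP->|kN].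
  by rewrite /q mulNr divfK // addNr.
by rewrite w0 // hc // mulr0 addr0.
Qed.

Section Final.
Variables (R : realType) (F : nat -> set (c00 R)) (hF : JTG F).
Variables (Xi1 Xi2 : set nat) (sigma : seq (c00 R) -> nat).
Hypothesis hsigma : coding F Xi1 Xi2 sigma.
Variable G : set (c00 R).
Hypothesis hG : G = F2s F Xi1 sigma \/ G = Fs F Xi1 sigma.
Variables (X : completeNormedModType R) (iota : {linear c00 R -> X}).
Hypothesis hX : completion_for G iota.
Variable Y : set X.
Hypothesis hY : closed_subspace Y.
Hypothesis hYinf : infinite_dim Y.

Let iota_lin (c : R) a b : iota (c *: a + b) = c *: iota a + iota b.
Proof. exact: linearP. Qed.

Let iota_lower (a : c00 R) k : 1 * `|a k : R| <= `|iota a|.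
Proof. by rewrite mul1r; exact: (coord_le hF hG hX). Qed.

(** Coordinates on the whole completion: the range of [iota] is dense, and coordinates are bounded
    by the norm since [G] contains F_0. *)
Let cf := coordinate ltr01 iota_lin iota_lower.

Let dense_iota x : Lspan iota x.
Proof.
apply/LspanP => e e0; have [_ h] := hX.
have [|y [xy [a _ aE]]] := h (ball x e) _ (ball_open x e).
  by exists x; exact: ballxx.
by exists a; move: xy; rewrite -aE -ball_normE /= distrC.
Qed.

Let approx x (e : R) : 0 < e -> exists a, `|iota a - x| < e.
Proof. by have /LspanP h := @dense_iota x; exact: h. Qed.

Let cf_lin k (c : R) x y : cf (c *: x + y) k = c * cf x k + cf y k.
Proof. by apply: coordinate_lin; exact: dense_iota. Qed.

Let cfP x (a : c00 R) k : `|(a k : R) - cf x k| <= `|iota a - x|.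
Proof. by have := coordinateP ltr01 iota_lin iota_lower x a k; rewrite mul1r. Qed.

(** Coordinates separate points because norming functionals are finitely supported. First [f] is
    chosen to norm [a] near [x], then [a'] so close to [x] that its small coordinates make
    [act f a'] small against the l_1 norm of [f]. *)
Lemma cf_total x : (forall k, cf x k = 0) -> x = 0.
Proof.
move=> x0; apply/eqP; rewrite -normr_le0.
apply: (@ler_forall_eps _ _ 5) => // e e0.
have [a ha] := approx x e0.
have [f Gf fa] := G_act_gt hX a e0.
pose l := l1norm f + 1; have l0 : 0 < l by rewrite ltr_wpDl ?l1norm_ge0.
pose e' := Num.min e (e / l).
have e'0 : 0 < e' by rewrite lt_min e0 divr_gt0.
have [a' ha'] := approx x e'0.
have fa' : `|act f a'| <= e.
  rewrite actC; apply: (@le_trans _ _ (e / l * l1norm f)).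
    apply: le_act_l1norm => n; have := cfP x a' n; rewrite x0 subr0 => h.
    by apply: (le_trans h); apply: (le_trans (ltW ha')); rewrite ge_min lexx orbT.
  rewrite -mulrA ler_piMr ?(ltW e0) // mulrC ler_pdivrMr // mul1r /l lerDl //.
have faa : `|act f (a - a')| <= 2 * e.
  apply: le_trans (G_act_norm_le hX _ Gf) _; rewrite linearB /=.
  rewrite (_ : _ - _ = (iota a - x) - (iota a' - x)); last by rewrite opprB addrA subrK.
  apply: le_trans (ler_normB _ _) _.
  have : `|iota a' - x| <= e by apply: (le_trans (ltW ha')); rewrite ge_min lexx.
  by have := ltW ha; lra.
have xa : `|x| <= `|iota a| + `|iota a - x|.
  by rewrite -{1}[x](subKr (iota a)); exact: ler_normB.
have h1 := ler_norm (act f a'); have h2 := ler_norm (act f (a - a')).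
move: h2 faa; rewrite actBr => h2 faa.
have := ltW ha; lra.
Qed.

Lemma tail_vector N : exists y, [/\ Y y, forall k, (k < N)%N -> cf y k = 0 & exists n, (N <= n)%N /\ cf y n = 1].
Proof.
have [Y0 YL _] := hY.
have [m [v [Yv hv]]] := @finite_codimension _ _ Y (fun k x => cf x k) N YL Y0 cf_lin.
have : exists y, [/\ Y y, y != 0 & forall k, (k < N)%N -> cf y k = 0].
  apply: contrapT => nex; apply: hYinf; exists m, (fun i : 'I_m => v i) => x Yx.
  have [c hc] := hv x Yx; exists (fun i : 'I_m => c i); apply/eqP; rewrite -subr_eq0.
  apply: contra_notT nex => h; exists (x - \sum_(i < m) c i *: v i); split=> //.
  by rewrite addrC -scaleN1r; apply: (YL) => //; exact: (subspace_sum (n := m) c Y0 YL (fun i _ => Yv i)).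
move=> [y [Yy y0 yN]].
have [n yn] : exists n, cf y n != 0.
  apply: contrapT => h; move/eqP: y0; apply; apply: cf_total => k.
  by apply/eqP; apply: contra_notT h => hk; exists k.
have cfZ (c : R) k : cf (c *: y) k = c * cf y k.
  have cf0 : cf 0 k = 0.
    by have := cf_lin k (-1) 0 0; rewrite scaler0 addr0 mulN1r addNr.
  by have := cf_lin k c y 0; rewrite addr0 cf0 addr0.
exists ((cf y n)^-1 *: y); split.
- by rewrite -[_ *: _]addr0; exact: YL.
- by move=> k kN; rewrite cfZ (yN k kN) mulr0.
- exists n; split; last by rewrite cfZ mulVf.
  by rewrite leqNgt; apply: contra yn => /yN ->.
Qed.

Lemma hump N (eta : R) : 0 < eta -> exists (x : c00 R) y,
  [/\ Y y, supp_ge N x, `|iota x - y| <= eta & exists n, x n = 1].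
Proof.
move=> eta0; have [y [Yy yN [n [Nn yn]]]] := tail_vector N.
pose K := 1 + \sum_(k < N) `|iota (unitvec k)| + `|iota (unitvec n)|.
have K0 : 0 < K by rewrite /K -addrA ltr_pwDl // addr_ge0 // sumr_ge0.
pose e := eta / K; have e0 : 0 < e by rewrite divr_gt0.
have [a ha] := approx y e0.
have a_le k : `|(a k : R) - cf y k| <= e := le_trans (cfP y a k) (ltW ha).
pose h : c00 R := \sum_(k < N) (a k : R) *: unitvec k.
(* The first [N] coordinates of [a] are erased and the n-th is reset to exactly 1. Each altered
   coordinate was off by at most e, so the correction costs at most e * (K - 1). *)
pose x : c00 R := a - h - ((a n : R) - 1) *: unitvec n.
have hE k : h k = (if (k < N)%N then a k else 0) :> R.
  rewrite /h c00_sum; case: ifPn => kN.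
    rewrite (bigD1 (Ordinal kN)) //= [X in X + _](_ : _ = (a k : R) * (k == k)%:R) // eqxx mulr1.
    rewrite big1 ?addr0 // => i; rewrite -val_eqE /= => ik.
    by rewrite [LHS](_ : _ = (a i : R) * (k == i)%:R) // eq_sym (negbTE ik) mulr0.
  rewrite big1 // => i _; rewrite [LHS](_ : _ = (a i : R) * (k == i)%:R) //.
  by rewrite gtn_eqF ?mulr0 // (leq_trans (ltn_ord i)) // leqNgt.
have xE k : x k = (a k : R) - h k - ((a n : R) - 1) * (k == n)%:R :> R by [].
exists x, y; split=> //.
- move=> k; apply: contraTT; rewrite -ltnNge negbK => kN; apply/eqP.
  by rewrite xE hE kN subrr (ltn_eqF (leq_trans kN Nn)) mulr0 subr0.
- have -> : iota x - y = (iota a - y) - (\sum_(k < N) (a k : R) *: iota (unitvec k)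
      + ((a n : R) - 1) *: iota (unitvec n)).
    rewrite /x !linearB /= linearZ /= /h linear_sum /= opprD.
    under eq_bigr do rewrite linearZ /=.
    by rewrite addrACA addrA [_ - _ - y]addrAC -!addrA.
  apply: le_trans (ler_normB _ _) _.
  have -> : eta = e + e * (\sum_(k < N) `|iota (unitvec k)| + `|iota (unitvec n)|).
    by rewrite -{1}[e]mulr1 -mulrDr addrA divfK // gt_eqF.
  rewrite lerD ?(ltW ha) //; apply: le_trans (ler_normD _ _) _; rewrite mulrDr lerD //.
    apply: le_trans (ler_norm_sum _ _ _) _; rewrite mulr_sumr; apply: ler_sum => k _.
    rewrite normrZ ler_wpM2r //; have := a_le k; rewrite yN ?subr0 //.
  by rewrite normrZ ler_wpM2r //; have := a_le n; rewrite yn.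
- exists n; rewrite [LHS]xE hE ltnNge Nn eqxx /=; ring.
Qed.

(** Humps close to [Y] span a block subspace, which contains a vector [w] small on elementary
    functionals. Each hump has a coordinate equal to 1, so the coefficients of [w] are coordinates
    of [w], at most 1, and the same combination of vectors of [Y] stays close. *)
Lemma almost_elementary_null N (eta : R) : 0 < eta -> exists (w : c00 R) z,
  [/\ Y z, supp_ge N w, `|iota w| = 1, `|iota w - z| <= eta &
   forall x, elementary F Xi1 sigma x -> `|act x w| <= eta].
Proof.
move=> eta0; have [Y0 YL _] := hY.
pose P (k : nat) (v : c00 R) := (exists n, v n = 1) /\ exists2 y, Y y & `|iota v - y| <= eta * 2 ^- k.+1.
have [|b [x [bx Px]]] := @blocks_exist R P.
  move=> k M; have [|v [y [Yy vM vy [n vn]]]] := @hump M (eta * 2 ^- k.+1).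
    by rewrite mulr_gt0 // invr_gt0 exprn_gt0.
  exists v; split=> //; first by apply: (c00_neq0P (n := n)); rewrite vn oner_eq0.
  by split; [exists n | exists y].
have /choice[y yP] : forall k, exists y, Y y /\ `|iota (x k) - y| <= eta * 2 ^- k.+1.
  by move=> k; have [_ [y Yy hy]] := Px k; exists y.
have [w [[n [a wE]] wN w1 ws]] := elementary_small hF hsigma hG hX N (blocks_rich bx) eta0.
have a1 k : (k < n)%N -> `|a k| <= 1.
  move=> kn; have [[m xm] _] := Px k.
  suff -> : a k = w m by rewrite -w1; exact: (coord_le hF hG hX).
  rewrite wE c00_sum (bigD1 (Ordinal kn)) //= [X in X + _](_ : _ = a k * (x k m : R)) // xm mulr1.
  rewrite big1 ?addr0 // => i; rewrite -val_eqE /= => ik.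
  rewrite [LHS](_ : _ = a i * (x i m : R)) // (blocks_disj bx ik) ?mulr0 //.
  by apply: (blocks_in bx); rewrite xm oner_eq0.
exists w, (\sum_(k < n) a k *: y k); split=> //.
  exact: (subspace_sum (n := n) a Y0 YL (fun k _ => proj1 (yP k))).
rewrite wE linear_sum -sumrB; apply: le_trans (ler_norm_sum _ _ _) _.
apply: (@le_trans _ _ (\sum_(k < n) eta * 2 ^- k.+1)).
  apply: ler_sum => k _; rewrite linearZ -scalerBr normrZ.
  rewrite -[leRHS]mul1r ler_pM //; first exact: a1.
  by case: (yP k).
by rewrite -mulr_sumr -[leRHS]mulr1 ler_wpM2l ?(ltW eta0) // geom_sum_le1.
Qed.

(** * Block sequences almost isometric to the basis of c_0 *)

Section Block.
Variables (eta : R) (b : nat -> nat) (w : nat -> c00 R).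
Hypothesis eta0 : 0 < eta.
Hypothesis bw : blocks b w.
Hypothesis w1 : forall k, `|iota (w k)| = 1.
Hypothesis ws : forall k x, elementary F Xi1 sigma x ->
  `|act x (w k)| <= eta * 2 ^- k.+1 / (b k).+1%:R.

(* If d functionals make up [f], then [k0] is the first block reaching d. *)
Lemma G_single_block f : G f -> exists k0, (forall k, (k < k0)%N -> act f (w k) = 0) /\
  forall k, (k0 < k)%N -> `|act f (w k)| <= eta * 2 ^- k.+1.
Proof.
have e2 k : 0 <= eta * 2 ^- k.+1 by rewrite mulr_ge0 ?(ltW eta0) // invr_ge0 exprn_ge0.
move=> /(G_form hG)[F0f|[d [a [x [a1 ex xd ->]]]]].
  have [n fE] := F0P hF F0f.
  have fn k : act f (w k) != 0 -> w k n != 0.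
    case: fE => ->; rewrite ?actNl ?oppr_eq0 act_unitvec //.
  have [[k0 hk0]|nex] := pselect (exists k0, w k0 n != 0); last first.
    exists 0%N; split=> // k _; have [->|/fn h] := eqVneq (act f (w k)) 0; first by rewrite normr0.
    by exfalso; apply: nex; exists k.
  have other k : k != k0 -> act f (w k) = 0.
    move=> kk0; apply/eqP; apply: contraT => /fn; rewrite (blocks_disj bw kk0) ?eqxx //.
    exact: (blocks_in bw).
  exists k0; split=> k kk; first by rewrite other // ltn_eqF.
  by rewrite other ?normr0 // gtn_eqF.
have ex0 : exists k, (d <= b k.+1)%N.
  by exists d; apply: ltnW; exact: (blocks_ge d.+1 bw).
have [k0 dk0 k0min] := ex_minnP ex0; exists k0; split=> k kk.
  rewrite act_suml big1 // => i _; rewrite actZl act_disj ?mulr0 // => n wn.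
  apply/eqP; apply: contraT => xn; have := xd i n xn.
  have /andP[_ h] := blocks_in bw wn.
  have : (b k.+1 < d)%N by rewrite ltnNge; apply/negP => /k0min; rewrite leqNgt kk.
  lia.
(* The divisor in [ws] thus absorbs the number d of functionals. *)
have db : (d <= (b k).+1)%N by apply: leqW; apply: leq_trans dk0 _; exact: (blocks_mono bw).
rewrite act_suml; apply: le_trans (ler_norm_sum _ _ _) _.
apply: (@le_trans _ _ (\sum_(i < d) eta * 2 ^- k.+1 / (b k).+1%:R)).
  apply: ler_sum => i _; rewrite actZl normrM -[leRHS]mul1r ler_pM //; exact: ws.
rewrite sumr_const card_ord -[leLHS]mulr_natl mulrCA ler_piMr //.
by rewrite ler_pdivrMr ?ltr0n // mul1r ler_nat.
Qed.

Lemma combination_upper (a : c00 R) (M : R) : 0 <= M -> (forall k, `|a k : R| <= M) ->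
  `|iota (combination w a)| <= (1 + eta) * M.
Proof.
move=> M0 aM; have [N aN] := c00_supp_lt a; rewrite (combinationE w aN).
rewrite -subr_le0; apply: (@ler_forall_eps _ _ 1) => // e e0; rewrite mul1r.
set v := \sum_(i < N) _; have [f Gf fv] := G_act_gt hX v e0.
have [k0 [lt0 gt0]] := G_single_block Gf.
have : `|act f v| <= (1 + eta) * M; last by have := ler_norm (act f v); lra.
rewrite act_sumr; apply: le_trans (ler_norm_sum _ _ _) _.
apply: (@le_trans _ _ (\sum_(i < N) ((if i == k0 :> nat then M else 0) + M * (eta * 2 ^- i.+1)))).
  apply: ler_sum => i _; rewrite actZr normrM.
  have e2 : 0 <= M * (eta * 2 ^- i.+1) by rewrite !mulr_ge0 ?(ltW eta0) // invr_ge0 exprn_ge0.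
  case: (ltngtP i k0) => ik.
  - by rewrite lt0 // normr0 mulr0 add0r.
  - by rewrite add0r ler_pM //; exact: gt0.
  - rewrite -[leLHS]addr0 lerD // -[leRHS]mulr1 ler_pM //.
    by apply: le_trans (G_act_norm_le hX (w i) Gf) _; rewrite w1.
rewrite big_split /= mulrDl mul1r lerD //.
  rewrite -big_mkcond /= sumr_const -[leLHS]mulr_natl ler_piMl //.
  rewrite lern1.
  by apply/card_le1_eqP => i j; rewrite !unfold_in => /eqP ik /eqP jk; apply/val_inj; rewrite /= ik jk.
rewrite -mulr_sumr -mulr_sumr mulrCA ler_wpM2l ?(ltW eta0) //.
by rewrite -[leRHS]mulr1 ler_wpM2l // geom_sum_le1.
Qed.

Lemma c00_argmax (a : c00 R) : exists k, forall l, `|a l : R| <= `|a k : R|.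
Proof.
have [N aN] := c00_supp_lt a.
have : exists k, forall l, (l < N)%N -> `|a l : R| <= `|a k : R|.
  elim: N {aN} => [|N [k hk]]; first by exists 0%N.
  have [le|lt] := leP `|a N : R| `|a k : R|.
    by exists k => l; rewrite ltnS leq_eqVlt => /orP[/eqP->//|]; exact: hk.
  exists N => l; rewrite ltnS leq_eqVlt => /orP[/eqP->//|/hk h].
  exact: le_trans h (ltW lt).
move=> [k hk]; exists k => l; have [/hk//|Nl] := ltnP l N.
by rewrite (supp_ltNge aN Nl) normr0.
Qed.

Hypothesis eta1 : eta <= 1 / 2.

Lemma combination_lower (a : c00 R) k : (1 - 2 * eta) * `|a k : R| <= `|iota (combination w a)|.
Proof.
have eta0' := eta0; have eta1' := eta1; have eta_lt1 : eta < 1 by lra.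
have [k1 k1max] := c00_argmax a; pose M : R := `|a k1 : R|.
have lo0 : 0 <= 1 - 2 * eta by lra.
have M0 : 0 <= M by rewrite /M.
apply: (@le_trans _ _ ((1 - 2 * eta) * M)); first by apply: ler_wpM2l => //; exact: k1max.
have [->|aM0] := eqVneq M 0; first by rewrite mulr0.
have [N aN] := c00_supp_lt a; rewrite (combinationE w aN).
have k1N : (k1 < N)%N by apply: aN; move: aM0; rewrite /M normr_eq0.
have [f Gf] := G_act_gt hX (w k1) eta0; rewrite w1 => fw.
have [k0 [lt0 gt0]] := G_single_block Gf.
(* Otherwise [act f (w k1)] would be 0 or at most eta, whereas it exceeds 1 - eta, which is at least
   1 / 2. *)
have k01 : k0 = k1.
  case: (ltngtP k0 k1) => // [lt|gt]; last first.
    by move: fw; rewrite lt0 // subr_lt0 ltNge (ltW eta_lt1).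
  have h := gt0 k1 lt; have h' := ler_norm (act f (w k1)).
  have : eta * 2 ^- k1.+1 <= eta.
    by rewrite ler_piMr ?(ltW eta0) // invf_le1 ?exprn_gt0 // exprn_ege1 // ler1n.
  by move=> h2; exfalso; lra.
subst k0.
apply: le_trans (G_act_norm_le hX _ Gf).
rewrite act_sumr (bigD1 (Ordinal k1N)) //= actZr.
set S := \sum_(_ < N | _) _.
have Sle : `|S| <= M * eta.
  apply: le_trans (ler_norm_sum _ _ _) _.
  apply: (@le_trans _ _ (\sum_(i < N) M * (eta * 2 ^- i.+1))).
    rewrite big_mkcond /=; apply: ler_sum => i _.
    have e2 : 0 <= M * (eta * 2 ^- i.+1) by rewrite !mulr_ge0 ?(ltW eta0) // invr_ge0 exprn_ge0.
    case: ifP => //; rewrite -val_eqE /= actZr normrM neq_ltn => /orP[ik|ki].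
      by rewrite lt0 // normr0 mulr0.
    by rewrite ler_pM //; exact: gt0.
  rewrite -mulr_sumr ler_wpM2l // -mulr_sumr -[leRHS]mulr1 ler_wpM2l ?(ltW eta0) //.
  exact: geom_sum_le1.
have h1 : `|(a k1 : R) * act f (w k1)| - `|S| <= `|(a k1 : R) * act f (w k1) + S|.
  by have := lerB_normD ((a k1 : R) * act f (w k1)) S.
apply: le_trans h1; rewrite normrM -/M.
have : M * (1 - eta) <= M * `|act f (w k1)|.
  by rewrite ler_wpM2l //; have := ler_norm (act f (w k1)); lra.
lra.
Qed.

End Block.

Lemma c0_subspace (eps : R) : 0 < eps -> exists Z : set X,
  [/\ Z `<=` Y, closed_subspace Z & isomorphic_within (1 + eps) Z [set: c0 R]].
Proof.
move=> eps0; have [Y0 YL Ycl] := hY.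
(* Solves (1 + 2 * eta) / (1 - 3 * eta) = 1 + eps, the ratio of the two estimates obtained for
   [combination z]. *)
pose eta := eps / (5 + 3 * eps).
have D0 : 0 < 5 + 3 * eps by rewrite addr_gt0 // mulr_gt0.
have eta0 : 0 < eta by rewrite divr_gt0.
have eta_eps : eta * (5 + 3 * eps) = eps by rewrite divfK // gt_eqF.
have eta3 : 3 * eta < 1.
  by rewrite /eta mulrA ltr_pdivrMr // mul1r ltrDr.
pose T := (nat * c00 R * X)%type.
pose Q (k : nat) (s s' : T) := let: (N, _, _) := s in let: (N', v, z) := s' in
  [/\ Y z, supp_ge N v /\ supp_lt N' v, `|iota v| = 1, `|iota v - z| <= eta * 2 ^- k.+1 &
  forall x, elementary F Xi1 sigma x -> `|act x v| <= eta * 2 ^- k.+1 / N.+1%:R].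
have [|f [_ fQ]] := @dep_choice T Q (0%N, 0, 0).
  move=> k [[N v] z]; have e2 : 0 < eta * 2 ^- k.+1 / N.+1%:R.
    by rewrite divr_gt0 // mulr_gt0 // invr_gt0 exprn_gt0.
  have [v' [z' [Yz vN v1 vz vs]]] := almost_elementary_null N e2.
  have [N' vN'] := c00_supp_lt v'; exists (N', v', z'); split=> //.
  apply: (le_trans vz); rewrite ler_pdivrMr // ler_peMr ?ler1n //.
  by rewrite mulr_ge0 ?(ltW eta0) // invr_ge0 exprn_ge0.
pose b k := (f k).1.1; pose w k := (f k.+1).1.2; pose z k := (f k.+1).2.
have fP k : [/\ Y (z k), supp_ge (b k) (w k) /\ supp_lt (b k.+1) (w k), `|iota (w k)| = 1,
    `|iota (w k) - z k| <= eta * 2 ^- k.+1 &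
    forall x, elementary F Xi1 sigma x -> `|act x (w k)| <= eta * 2 ^- k.+1 / (b k).+1%:R].
  by have := fQ k; rewrite /b /w /z; case: (f k) => [[N v] y]; case: (f k.+1) => [[N' v'] y'].
have w1 k : `|iota (w k)| = 1 by case: (fP k).
have bw : blocks b w.
  move=> k; have [_ [h1 h2] _ _ _] := fP k; split=> //.
  by apply: contra_eq_neq (w1 k) => ->; rewrite linear0 normr0 eq_sym oner_neq0.
have ws k x : elementary F Xi1 sigma x -> `|act x (w k)| <= eta * 2 ^- k.+1 / (b k).+1%:R.
  by case: (fP k) => _ _ _ _; exact.
have zY k : Y (z k) by case: (fP k).
(* Passing from the blocks [w k] to the vectors [z k] of [Y] costs one more eta in each estimate. *)
have dist (a : c00 R) (M : R) : 0 <= M -> (forall k, `|a k : R| <= M) ->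
    `|iota (combination w a) - combination z a| <= eta * M.
  move=> M0 aM; have [N aN] := c00_supp_lt a.
  rewrite (combinationE w aN) (combinationE z aN) linear_sum -sumrB.
  apply: le_trans (ler_norm_sum _ _ _) _.
  apply: (@le_trans _ _ (\sum_(i < N) M * (eta * 2 ^- i.+1))).
    apply: ler_sum => i _; rewrite linearZ -scalerBr normrZ ler_pM //.
    by case: (fP i).
  rewrite -mulr_sumr -mulr_sumr mulrCA ler_wpM2l ?(ltW eta0) //.
  by rewrite -[leRHS]mulr1 ler_wpM2l // geom_sum_le1.
have eta12 : eta <= 1 / 2 by lra.
have lo0 : 0 < 1 - 3 * eta by lra.
have lower (a : c00 R) k : (1 - 3 * eta) * `|a k : R| <= `|combination z a|.
  have [k1 k1max] := c00_argmax a.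
  apply: (@le_trans _ _ ((1 - 3 * eta) * `|a k1 : R|)); first by rewrite ler_wpM2l // ltW.
  have h1 := combination_lower eta0 bw w1 ws eta12 a k1.
  have h2 := dist a _ (normr_ge0 _) k1max.
  have h3 : `|iota (combination w a)| <= `|combination z a| + `|iota (combination w a) - combination z a|.
    by rewrite -{1}[iota _](subrKC (combination z a)); exact: ler_normD.
  lra.
have upper (a : c00 R) (M : R) : 0 <= M -> (forall k, `|a k : R| <= M) ->
    `|combination z a| <= (1 + 2 * eta) * M.
  move=> M0 aM; have h1 := combination_upper eta0 bw w1 ws M0 aM.
  have h2 := dist a M M0 aM.
  have h3 : `|combination z a| <= `|iota (combination w a)| + `|iota (combination w a) - combination z a|.
    by rewrite -{1}[combination z a](subKr (iota (combination w a))); exact: ler_normB.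
  lra.
exists (Lspan (combination z)); split.
- have -> : Y = closure Y by apply/closure_id.
  apply: closureS => _ [a _ <-]; have [N aN] := c00_supp_lt a.
  rewrite (combinationE z aN).
  exact: (subspace_sum (n := N) (fun i => a i : R) Y0 YL (fun i _ => zY i)).
- split; first exact: (Lspan0 (combination_lin z)).
    exact: (Lspan_lin (combination_lin z)).
  exact: closed_closure.
- apply: (isomorphic_c0 lo0 (combination_lin z) lower (hi := 1 + 2 * eta)) => //.
    by rewrite addr_ge0 // mulr_ge0 // ltW.
  rewrite ler_pdivrMr //; lra.
Qed.

End Final.

Theorem theoremB12 (R : realType) (F : nat -> set (c00 R)) (hF : JTG F)
    (Xi1 Xi2 : set nat) (sigma : seq (c00 R) -> nat)
    (hsigma : coding F Xi1 Xi2 sigma)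
    (G : set (c00 R)) (hG : G = F2s F Xi1 sigma \/ G = Fs F Xi1 sigma)
    (X : completeNormedModType R) (iota : {linear c00 R -> X})
    (hX : completion_for G iota)
    (Y : set X) (hY : closed_subspace Y) (hYinf : infinite_dim Y)
    (eps : R) (heps : 0 < eps) :
  exists Z : set X,
    [/\ Z `<=` Y, closed_subspace Z &
        isomorphic_within (1 + eps) Z [set: c0 R]].
Proof. exact: (c0_subspace hF hsigma hG hX hY hYinf heps). Qed.
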